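(* Let $d$ be a metric on $\partial\mathbf{H}^n_{\mathbb K}=\mathfrak H_{\mathbb K}\cup\{\infty\}$ which induces the same topology on $\partial\mathbf{H}^n_{\mathbb K}$ as the Korányi metric $d_{\mathfrak H}$ and has the same remote point $\infty$ as $d_{\mathfrak H}$. Assume further that $\mathcal M_d=\mathcal M_{d_{\mathfrak H}}$. Then there exist $\alpha\in(0,1]$ and $\beta>0$ such that $d=\beta\cdot d_{\mathfrak H}^{\alpha}$.
   Context: $\mathbb K$ is one of $\mathbb R,\mathbb C,\mathbb H,\mathbb O$ (reals, complex numbers, quaternions, octonions), with conjugation $z\mapsto\overline z$ (the identity if $\mathbb K=\mathbb R$) and norm $|z|$; $n\ge 2$ is an integer, and $n=2$ if $\mathbb K=\mathbb O$. Put $\Im(\mathbb K)=\{z\in\mathbb K: z=-\overline z\}$, $\operatorname{Im}z=(z-\overline z)/2$, and $\|\zeta\|^2=\sum_i|\zeta_i|^2$ for $\zeta\in\mathbb K^{n-1}$. The $\mathbb K$-Heisenberg group $\mathfrak H_{\mathbb K}$ is the set $\mathbb K^{n-1}\times\Im(\mathbb K)$ with the multiplication $(\zeta,v)*(\zeta',v')=(\zeta+\zeta',\,v+v'+2\omega(\zeta,\zeta'))$, where $\omega(\zeta,\zeta')=\operatorname{Im}\big(\sum_i\overline{\zeta'_i}\zeta_i\big)$; thus $(\zeta,v)^{-1}=(-\zeta,-v)$, and the origin is $o=(0,0)$. The boundary of $\mathbb K$-hyperbolic space $\mathbf H^n_{\mathbb K}$ is identified with $\partial\mathbf{H}^n_{\mathbb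 K}=\mathfrak H_{\mathbb K}\cup\{\infty\}$. The Korányi gauge is $|(\zeta,v)|_{\mathbb K}=(\|\zeta\|^4+|v|^2)^{1/4}$ and the Korányi metric is $d_{\mathfrak H}(p,q)=|q^{-1}*p|_{\mathbb K}$ on $\mathfrak H_{\mathbb K}$. A metric on $\partial\mathbf{H}^n_{\mathbb K}$ with remote point $\infty$ means a metric $d$ on $S=\mathfrak H_{\mathbb K}$ extended to $\overline S=S\cup\{\infty\}$ by $d(p,\infty)=+\infty$ for $p\in S$ and $d(\infty,\infty)=0$. The $d$-topology on $\overline S$ is the one extending the metric topology of $S$ for which the sets $\{q\in S:d(o,q)>R\}\cup\{\infty\}$, $R>0$, are basic neighbourhoods of $\infty$. For pairwise distinct $p_1,\dots,p_4\in\overline S$ the metric cross-ratio is $|\mathbb X^d|(p_1,p_2,p_3,p_4)=\frac{d(p_4,p_2)}{d(p_4,p_1)}\cdot\frac{d(p_3,p_1)}{d(p_3,p_2)}$, where, if one of the points is $\infty$, the two factors containing $\infty$ are cancelled. The Möbius group $\mathcal M_d$ is the group of homeomorphisms of $\overline S$ (in the $d$-topology) which leave $|\mathbb X^d|$ invariant on all quadruples of pairwise distinct points of $\overline S$. *)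

(* Defs.v *)
From HB Require Import structures.
From mathcomp Require Import all_boot all_order all_algebra.
From mathcomp Require Import all_classical all_reals all_analysis.

Set Implicit Arguments.
Unset Strict Implicit.
Unset Printing Implicit Defensive.

Import Order.TTheory GRing.Theory Num.Theory.

Local Open Scope classical_set_scope.
Local Open Scope ring_scope.

Inductive scalars := Reals | Complexes | Quaternions | Octonions.

(* Number of Cayley-Dickson doublings of the reals that produce the algebra. *)
Definition cd_level (K : scalars) : nat :=
  match K with Reals => 0 | Complexes => 1 | Quaternions => 2 | Octonions => 3
  end.

Coercion cd_level : scalars >-> nat.

(* The underlying real vector space of the k-th Cayley-Dickson algebra. *)
Fixpoint cd (R : realType) (k : nat) : lmodType R :=
  if k is k'.+1 then (cd R k' * cd R k')%type else R^o.

Fixpoint cd_conj (R : realType) (k : nat) : cd R k -> cd R k :=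
  match k with
  | 0 => fun z => z
  | k'.+1 => fun z => (cd_conj z.1, - z.2)
  end.

(* (a, b) (c, d) = (a c - conj(d) b, d a + b conj(c)). *)
Fixpoint cd_mul (R : realType) (k : nat) : cd R k -> cd R k -> cd R k :=
  match k with
  | 0 => fun z w : R => z * w
  | k'.+1 => fun z w =>
      (cd_mul z.1 w.1 - cd_mul (cd_conj w.2) z.2,
       cd_mul w.2 z.1 + cd_mul z.2 (cd_conj w.1))
  end.

Fixpoint cd_sqnorm (R : realType) (k : nat) : cd R k -> R :=
  match k with
  | 0 => fun z : R => z ^+ 2
  | k'.+1 => fun z => cd_sqnorm z.1 + cd_sqnorm z.2
  end.

Definition cd_norm (R : realType) (k : nat) (z : cd R k) : R :=
  Num.sqrt (cd_sqnorm z).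

Lemma cd_conjB (R : realType) (k : nat) : {morph @cd_conj R k : x y / x - y}.
Proof.
elim: k => [//|k IHk] [a b] [c e] /=.
by rewrite IHk !opprD.
Qed.

Lemma cd_conjK (R : realType) (k : nat) : involutive (@cd_conj R k).
Proof. by elim: k => [//|k IHk] [a b] /=; rewrite IHk opprK. Qed.

Lemma cd_conjZ (R : realType) (k : nat) (a : R) (z : cd R k) :
  cd_conj (a *: z) = a *: cd_conj z.
Proof.
elim: k z => [//|k IHk] [x y] /=.
by rewrite IHk; congr (_, _); rewrite scalerN.
Qed.

Definition imaginary (R : realType) (k : nat) : {pred cd R k} :=
  [pred z | z == - cd_conj z].

Lemma imaginary_zmod_closed (R : realType) (k : nat) :
  zmod_closed (@imaginary R k).
Proof.
have conj0 : cd_conj (0 : cd R k) = 0.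
  by rewrite -[X in cd_conj X](subrr 0) cd_conjB subrr.
split=> [|x y /eqP xE /eqP yE]; rewrite inE; apply/eqP.
  by rewrite conj0 oppr0.
by rewrite cd_conjB opprB addrC {1}xE {1}yE opprK.
Qed.

HB.instance Definition _ (R : realType) (k : nat) :=
  GRing.isZmodClosed.Build (cd R k) (@imaginary R k)
    (imaginary_zmod_closed R k).

Record imag (R : realType) (k : nat) := Imag {
  imag_val :> cd R k;
  imag_valP : imag_val \in @imaginary R k }.

HB.instance Definition _ (R : realType) (k : nat) :=
  [isSub for @imag_val R k].
HB.instance Definition _ (R : realType) (k : nat) :=
  [Choice of imag R k by <:].
HB.instance Definition _ (R : realType) (k : nat) :=
  [SubChoice_isSubZmodule of imag R k by <:].

Lemma im_subproof (R : realType) (k : nat) (z : cd R k) :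
  2^-1 *: (z - cd_conj z) \in @imaginary R k.
Proof. by rewrite inE cd_conjZ cd_conjB cd_conjK -scalerN opprB. Qed.

Definition im (R : realType) (k : nat) (z : cd R k) : imag R k :=
  Imag (im_subproof z).

Definition heis (R : realType) (k n : nat) : Type :=
  ('rV[cd R k]_n.-1 * imag R k)%type.

HB.instance Definition _ (R : realType) (k n : nat) :=
  Choice.on (heis R k n).

Definition omega (R : realType) (k n : nat) (z w : 'rV[cd R k]_n) : imag R k :=
  im (\sum_(i < n) cd_mul (cd_conj (w 0 i)) (z 0 i)).

Definition heis_mul (R : realType) (k n : nat) (p q : heis R k n) :
    heis R k n :=
  (p.1 + q.1, p.2 + q.2 + omega p.1 q.1 *+ 2).

Definition heis_inv (R : realType) (k n : nat) (p : heis R k n) : heis R k n :=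
  (- p.1, - p.2).

Definition heis_origin (R : realType) (k n : nat) : heis R k n := (0, 0).

Definition vec_norm (R : realType) (k n : nat) (z : 'rV[cd R k]_n) : R :=
  Num.sqrt (\sum_(i < n) cd_norm (z 0 i) ^+ 2).

Definition koranyi_gauge (R : realType) (k n : nat) (p : heis R k n) : R :=
  (vec_norm p.1 ^+ 4 + cd_norm (p.2 : cd R k) ^+ 2) `^ 4^-1.

Definition koranyi_dist (R : realType) (k n : nat) (p q : heis R k n) : R :=
  koranyi_gauge (heis_mul (heis_inv q) p).

Definition is_metric (R : realType) (T : Type) (d : T -> T -> R) : Prop :=
  [/\ forall x y, 0 <= d x y,
      forall x y, d x y = 0 <-> x = y,
      forall x y, d x y = d y x &
      forall x y z, d x z <= d x y + d y z].

(* The boundary is [option (heis R k n)], with [None] the point at infinity;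
   a metric with remote point [None] is given by its restriction [d] to
   [heis R k n]. *)
Definition ext_dist (R : realType) (T : Type) (d : T -> T -> R)
    (x y : option T) : \bar R :=
  match x, y with
  | Some p, Some q => (d p q)%:E
  | None, None => 0%E
  | _, _ => +oo%E
  end.

(* Alias of the boundary that carries the d-topology.  That topology is defined
   for every function [d]; when [d] is a metric, its balls and the sets
   {q | d(o, q) > R} together with infinity are open. *)
Definition bdry (R : realType) (k n : nat)
  (d : heis R k n -> heis R k n -> R) : Type := option (heis R k n).

HB.instance Definition _ (R : realType) (k n : nat)
  (d : heis R k n -> heis R k n -> R) := Choice.on (bdry d).

Definition bdry_open (R : realType) (k n : nat)
    (d : heis R k n -> heis R k n -> R) (U : set (bdry d)) : Prop :=
  (forall p : heis R k n, U (Some p) ->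
     exists2 r : R, 0 < r & forall q, d p q < r -> U (Some q)) /\
  (U None ->
     exists2 r : R, 0 < r & forall q, r < d (heis_origin R k n) q -> U (Some q)).

Section bdry_topology.
Context (R : realType) (k n : nat) (d : heis R k n -> heis R k n -> R).

Let openT : bdry_open (d := d) setT.
Proof. by split=> [p|] _; exists 1. Qed.

Let openI : setI_closed (@bdry_open R k n d).
Proof.
move=> A B [A1 A2] [B1 B2]; split=> [p [/A1[r r0 rA] /B1[s s0 sB]]|].
  exists (Num.min r s); first by rewrite lt_min r0.
  by move=> q; rewrite lt_min => /andP[/rA ? /sB].
move=> [/A2[r r0 rA] /B2[s s0 sB]].
exists (Num.max r s); first by rewrite lt_max r0.
by move=> q; rewrite gt_max => /andP[/rA ? /sB].
Qed.

Let open_bigU (I : Type) (f : I -> set (bdry d)) :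
  (forall i, bdry_open (f i)) -> bdry_open (\bigcup_i f i).
Proof.
move=> fo; split=> [p|] [i _ fi].
  by have [r r0 rf] := (fo i).1 p fi; exists r => // q /rf; exists i.
by have [r r0 rf] := (fo i).2 fi; exists r => // q /rf; exists i.
Qed.

HB.instance Definition _ :=
  isOpenTopological.Build (bdry d) openT openI open_bigU.

End bdry_topology.

Definition homeomorphism (T U : topologicalType) (f : T -> U) : Prop :=
  continuous f /\
  exists g : U -> T, [/\ cancel f g, cancel g f & continuous g].

(* Replacing by 1 each distance to infinity realizes the cancellation: among
   pairwise distinct points infinity occurs at most once, and then in exactly
   one numerator and one denominator of the cross-ratio. *)
Definition cr_factor (R : realType) (T : Type) (d : T -> T -> R)
    (x y : option T) : R :=
  match x, y with Some p, Some q => d p q | _, _ => 1 end.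

Definition cross_ratio (R : realType) (T : Type) (d : T -> T -> R)
    (p1 p2 p3 p4 : option T) : R :=
  cr_factor d p4 p2 / cr_factor d p4 p1 *
  (cr_factor d p3 p1 / cr_factor d p3 p2).

Definition moebius (R : realType) (k n : nat)
    (d : heis R k n -> heis R k n -> R) :
    set (option (heis R k n) -> option (heis R k n)) :=
  [set f | @homeomorphism (bdry d) (bdry d) f /\
    forall p1 p2 p3 p4 : option (heis R k n), uniq [:: p1; p2; p3; p4] ->
      cross_ratio d (f p1) (f p2) (f p3) (f p4) = cross_ratio d p1 p2 p3 p4].

(* Main.v *)
Require Import Defs.
From HB Require Import structures.
From mathcomp Require Import all_boot all_order all_algebra.
From mathcomp Require Import all_classical all_reals all_analysis.
From mathcomp Require Import ring lra.

(* Left translations, dilations and the Koranyi inversion I all belong to the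
   common Moebius group. A Moebius map fixing infinity is a similarity of d, so
   translations are d-isometries (their ratio is a homomorphism that the
   dilations preserve), and the dilation of ratio t multiplies d by t^alpha.
   Let F(p) be the logarithm of d(o,p) / d_H(o,p)^alpha, up to a constant chosen
   so that the inversion gives F(Ip) = - F(p) and
     F(q^-1 p) = F(p) + F(q) + F((Iq)^-1 (Ip)).
   On horizontal and on vertical points I is a dilation, up to inverse, so that
   F = 0 there. If F <= M, then F >= -M, hence F(q^-1 p) >= F(p) + F(q) - M;
   since p^-1 p^-1 (2.p) is vertical, 3 F(p) <= 2 M. The supremum of F is thus
   nonpositive, and F = 0. *)

Set Implicit Arguments.
Unset Strict Implicit.
Unset Printing Implicit Defensive.

Import Order.TTheory GRing.Theory Num.Theory.

Local Open Scope classical_set_scope.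
Local Open Scope ring_scope.

(** * Cayley-Dickson algebras *)

Section CayleyDickson.
Context {R : realType}.

(** A point that is neither horizontal nor vertical is not carried to its image under I by a
    dilation, even up to group inverse, so I gives F = 0 directly only on two thin sets; the
    supremum argument reaches the rest. Its upper bound on F comes from dilation invariance: every
    point is rescaled into a Koranyi ball on which d(o,.) < 1. The identity for F(q^-1 p) is the
    invariance under I of the cross-ratio of infinity, p, o, q. The octonions shape the algebra.
    Products cannot be reassociated, so factors are moved across the real inner product by
    adjunction, and the cancellation (x a) conj(a) = |a|^2 x is derived from multiplicativity of the
    norm. With a = |zeta|^2 + v, the square |a|^2 is the fourth power of the gauge, and I turns a
    into its inverse; the distance formula for I thus becomes an identity between norms. For
    membership in the Koranyi Moebius group, continuity is checked through a quasi-triangle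
    inequality for fourth powers of the distance. Any finite constant serves there, hence the crude
    bounds. *)

Fixpoint cd_dot (k : nat) : cd R k -> cd R k -> R :=
  match k with
  | 0 => fun z w : R => z * w
  | k'.+1 => fun z w => cd_dot z.1 w.1 + cd_dot z.2 w.2
  end.

Fixpoint cd_one (k : nat) : cd R k :=
  match k with
  | 0 => (1 : R)
  | k'.+1 => (cd_one k', 0)
  end.

Implicit Types k : nat.

Lemma cd_conj0 k : cd_conj (0 : cd R k) = 0.
Proof. by rewrite -[X in cd_conj X](subrr 0) cd_conjB subrr. Qed.

Lemma cd_conjN k (x : cd R k) : cd_conj (- x) = - cd_conj x.
Proof. by rewrite -[- x]sub0r cd_conjB cd_conj0 sub0r. Qed.

Lemma cd_conjD k (x y : cd R k) : cd_conj (x + y) = cd_conj x + cd_conj y.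
Proof. by rewrite -[y in LHS]opprK cd_conjB cd_conjN opprK. Qed.

Lemma cd_mulD k :
  (forall x y z : cd R k, cd_mul (x + y) z = cd_mul x z + cd_mul y z) /\
  (forall x y z : cd R k, cd_mul z (x + y) = cd_mul z x + cd_mul z y).
Proof.
elim: k => [|k [IHl IHr]].
  by split=> x y z; [exact: mulrDl|exact: mulrDr].
split=> [] [a b] [c e] [g h] /=; rewrite ?cd_conjD ?IHl ?IHr;
  by congr (_, _); rewrite ?opprD; rewrite addrACA.
Qed.

Lemma cd_mulDl k (x y z : cd R k) : cd_mul (x + y) z = cd_mul x z + cd_mul y z.
Proof. exact: (cd_mulD k).1. Qed.

Lemma cd_mulDr k (x y z : cd R k) : cd_mul z (x + y) = cd_mul z x + cd_mul z y.
Proof. exact: (cd_mulD k).2. Qed.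

Lemma cd_mulZ k (a : R) :
  (forall x z : cd R k, cd_mul (a *: x) z = a *: cd_mul x z) /\
  (forall x z : cd R k, cd_mul z (a *: x) = a *: cd_mul z x).
Proof.
elim: k => [|k [IHl IHr]].
  by split=> x z; [exact: esym (mulrA a x z)|exact: mulrCA].
split=> [] [x y] [z w] /=; rewrite ?cd_conjZ ?IHl ?IHr; 
  by congr (_, _) => /=; [exact/esym/scalerBr|exact/esym/scalerDr].
Qed.

Lemma cd_mulZl k (a : R) (x z : cd R k) : cd_mul (a *: x) z = a *: cd_mul x z.
Proof. exact: (cd_mulZ k a).1. Qed.

Lemma cd_mulZr k (a : R) (x z : cd R k) : cd_mul z (a *: x) = a *: cd_mul z x.
Proof. exact: (cd_mulZ k a).2. Qed.

Lemma cd_mul0l k (z : cd R k) : cd_mul 0 z = 0.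
Proof. by rewrite -(scale0r (0 : cd R k)) cd_mulZl !scale0r. Qed.

Lemma cd_mul0r k (z : cd R k) : cd_mul z 0 = 0.
Proof. by rewrite -(scale0r (0 : cd R k)) cd_mulZr !scale0r. Qed.

Lemma cd_mulNl k (x z : cd R k) : cd_mul (- x) z = - cd_mul x z.
Proof. by rewrite -scaleN1r cd_mulZl scaleN1r. Qed.

Lemma cd_mulNr k (x z : cd R k) : cd_mul z (- x) = - cd_mul z x.
Proof. by rewrite -scaleN1r cd_mulZr scaleN1r. Qed.

Lemma cd_conjM k (x y : cd R k) :
  cd_conj (cd_mul x y) = cd_mul (cd_conj y) (cd_conj x).
Proof.
elim: k x y => [|k IHk]; first by move=> x y; exact: mulrC.
move=> [a b] [c e] /=; rewrite cd_conjB !IHk cd_conjN !cd_conjK.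
by rewrite !cd_mulNl cd_mulNr opprK opprD [X in (_, X)]addrC.
Qed.

Lemma cd_conj1 k : cd_conj (cd_one k) = cd_one k.
Proof. by elim: k => [//|k /= ->]; rewrite oppr0. Qed.

Lemma cd_mul1l k (x : cd R k) : cd_mul (cd_one k) x = x.
Proof.
elim: k x => [|k IHk] x; first exact: mul1r.
case: x => a b /=; rewrite IHk cd_mul0r cd_mul0l subr0 addr0.
congr (_, _).
by rewrite -[LHS]cd_conjK cd_conjM cd_conj1 IHk cd_conjK.
Qed.

Lemma cd_mul1r k (x : cd R k) : cd_mul x (cd_one k) = x.
Proof. by rewrite -[LHS]cd_conjK cd_conjM cd_conj1 cd_mul1l cd_conjK. Qed.

Lemma cd_dotC k (x y : cd R k) : cd_dot x y = cd_dot y x.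
Proof.
by elim: k x y => [|k IHk] x y /=; [exact: mulrC|rewrite !(IHk x.1) !(IHk x.2)].
Qed.

Lemma cd_dotDl k (x y z : cd R k) : cd_dot (x + y) z = cd_dot x z + cd_dot y z.
Proof.
elim: k x y z => [|k IHk] x y z /=; first exact: mulrDl.
by rewrite !IHk addrACA.
Qed.

Lemma cd_dotZl k (a : R) (x z : cd R k) : cd_dot (a *: x) z = a * cd_dot x z.
Proof.
elim: k x z => [|k IHk] x z /=; first by rewrite -[LHS]/(a * x * z) mulrA.
by rewrite !IHk mulrDr.
Qed.

Lemma cd_dotDr k (x y z : cd R k) : cd_dot z (x + y) = cd_dot z x + cd_dot z y.
Proof. by rewrite !(cd_dotC z) cd_dotDl. Qed.

Lemma cd_dotZr k (a : R) (x z : cd R k) : cd_dot z (a *: x) = a * cd_dot z x.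
Proof. by rewrite !(cd_dotC z) cd_dotZl. Qed.

Lemma cd_dotNl k (x z : cd R k) : cd_dot (- x) z = - cd_dot x z.
Proof. by rewrite -scaleN1r cd_dotZl mulN1r. Qed.

Lemma cd_dotNr k (x z : cd R k) : cd_dot z (- x) = - cd_dot z x.
Proof. by rewrite !(cd_dotC z) cd_dotNl. Qed.

Lemma cd_dotE k (x : cd R k) : cd_dot x x = cd_sqnorm x.
Proof. by elim: k x => [|k IHk] x //=; rewrite !IHk. Qed.

Lemma cd_dot_conj k (x y : cd R k) :
  cd_dot (cd_conj x) (cd_conj y) = cd_dot x y.
Proof.
by elim: k x y => [//|k IHk] x y /=; rewrite IHk cd_dotNl cd_dotNr opprK.
Qed.

Lemma cd_dot_conjl k (x y : cd R k) :
  cd_dot (cd_conj x) y = cd_dot x (cd_conj y).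
Proof. by rewrite -cd_dot_conj cd_conjK. Qed.

(** This replaces associativity at the octonion level. The doubling step uses adjunction on both
    sides; the right-hand form [IHr] follows from the left-hand one because conjugation is an
    isometry that reverses products. *)
Lemma cd_dot_adjl k (x y z : cd R k) :
  cd_dot (cd_mul x y) z = cd_dot y (cd_mul (cd_conj x) z).
Proof.
elim: k x y z => [|k IHl] x y z; first by rewrite /= mulrCA mulrA.
have IHr (u v w : cd R k) :
    cd_dot (cd_mul u v) w = cd_dot u (cd_mul w (cd_conj v)).
  rewrite -cd_dot_conj cd_conjM IHl cd_conjK.
  by rewrite -cd_dot_conj cd_conjM !cd_conjK.
case: x y z => [a b] [c e] [g h] /=.
rewrite !cd_dotDl !cd_dotDr !cd_dotNl !cd_dotNr.
rewrite (IHl a c) (IHr e a) (IHl (cd_conj e)) (IHr b) !cd_conjK.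
rewrite (cd_dotC b (cd_mul e g)) (IHr e g) (cd_dotC b (cd_mul h c)) (IHl h c).
rewrite cd_mulNr cd_mulNl cd_dotNr opprK !cd_dotNr; ring.
Qed.

Lemma cd_dot_adjr k (x y z : cd R k) :
  cd_dot (cd_mul x y) z = cd_dot x (cd_mul z (cd_conj y)).
Proof.
rewrite -cd_dot_conj cd_conjM cd_dot_adjl cd_conjK.
by rewrite -cd_dot_conj cd_conjM !cd_conjK.
Qed.

Lemma cd_sqnorm_ge0 k (x : cd R k) : 0 <= cd_sqnorm x.
Proof.
by elim: k x => [|k IHk] x /=; [exact: sqr_ge0|rewrite addr_ge0 ?IHk].
Qed.

Lemma cd_sqnorm_eq0 k (x : cd R k) : (cd_sqnorm x == 0) = (x == 0).
Proof.
elim: k x => [|k IHk] x /=; first by rewrite sqrf_eq0.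
by rewrite paddr_eq0 ?cd_sqnorm_ge0// !IHk; case: x.
Qed.

Lemma cd_sqnorm1 k : cd_sqnorm (cd_one k) = 1.
Proof.
elim: k => [|k IHk] /=; first exact: expr1n.
by rewrite IHk (eqP (_ : cd_sqnorm 0 == 0)) ?addr0// cd_sqnorm_eq0.
Qed.

Lemma cd_sqnormD k (x y : cd R k) :
  cd_sqnorm (x + y) = cd_sqnorm x + cd_sqnorm y + 2 * cd_dot x y.
Proof.
by rewrite -!cd_dotE cd_dotDl !cd_dotDr (cd_dotC y x); ring.
Qed.

Lemma cd_sqnormZ k (a : R) (x : cd R k) :
  cd_sqnorm (a *: x) = a ^+ 2 * cd_sqnorm x.
Proof. by rewrite -!cd_dotE cd_dotZl cd_dotZr mulrA. Qed.

Lemma cd_sqnormN k (x : cd R k) : cd_sqnorm (- x) = cd_sqnorm x.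
Proof. by rewrite -scaleN1r cd_sqnormZ sqrrN expr1n mul1r. Qed.

Lemma cd_sqnorm0 k : cd_sqnorm (0 : cd R k) = 0.
Proof. by apply/eqP; rewrite cd_sqnorm_eq0. Qed.

Lemma cd_sqnorm_conj k (x : cd R k) : cd_sqnorm (cd_conj x) = cd_sqnorm x.
Proof. by rewrite -!cd_dotE cd_dot_conj. Qed.

Lemma cd_sqnormD_le k (x y : cd R k) :
  cd_sqnorm (x + y) <= 2 * (cd_sqnorm x + cd_sqnorm y).
Proof.
have := cd_sqnorm_ge0 (x - y); rewrite !cd_sqnormD cd_sqnormN cd_dotNr; lra.
Qed.

Lemma cd_addr_conj k (x : cd R k) :
  x + cd_conj x = (2 * cd_dot (cd_one k) x) *: cd_one k.
Proof.
elim: k x => [|k IHk] x /=; first by rewrite -[RHS]/(2 * (1 * x) * 1); ring.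
case: x => a b /=; congr (_, _) => /=.
  rewrite -[LHS]/(a + cd_conj a) IHk (_ : cd_dot 0 b = 0) ?addr0//.
  by rewrite -(scale0r (0 : cd R k)) cd_dotZl mul0r.
by rewrite -[LHS]/(b - b) subrr scaler0.
Qed.

Lemma cd_imE k (x : cd R k) :
  im x = x - cd_dot (cd_one k) x *: cd_one k :> cd R k.
Proof.
rewrite /= -[cd_dot _ x](mulKf (_ : (2 : R) != 0)) ?pnatr_eq0//.
rewrite -scalerA -cd_addr_conj !scalerDr scalerN opprD addrA.
have {3}-> : x = (2^-1 + 2^-1 : R) *: x.
  by rewrite -[LHS]scale1r; congr (_ *: _); lra.
by rewrite scalerDl addrK.
Qed.

Lemma cd_mulC k : (k <= 1)%N -> forall x y : cd R k, cd_mul x y = cd_mul y x.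
Proof.
case: k => [|[|//]] _; first exact: mulrC.
move=> [a b] [c e] /=; congr (_, _) => /=.
  by rewrite -[LHS]/(a * c - e * b) -[RHS]/(c * a - b * e); ring.
by rewrite -[LHS]/(e * a + b * c) -[RHS]/(b * c + e * a); ring.
Qed.

(** Doubling a commutative associative algebra gives an associative one, so commutativity up to
    level 1 yields associativity up to level 2. [S] says that right multiplications commute. *)
Lemma cd_mulA k : (k <= 2)%N -> forall x y z : cd R k,
  cd_mul x (cd_mul y z) = cd_mul (cd_mul x y) z.
Proof.
elim: k => [|k IHk] k2; first exact: mulrA.
have A := IHk (ltnW k2); have C := cd_mulC k2.
have S (x y z : cd R k) : cd_mul (cd_mul x y) z = cd_mul (cd_mul x z) y.
  by rewrite -!A (C y).
move=> [a b] [c e] [g h] /=.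
rewrite !(cd_mulDl, cd_mulDr, cd_mulNl, cd_mulNr, cd_conjD, cd_conjN,
  cd_conjM, cd_conjK) !A; congr (_, _) => /=.
  rewrite (C a (cd_conj h)) (S (cd_conj h) a e) (C (cd_conj c)).
  rewrite (S (cd_conj h) (cd_conj c) b) (C g) (S (cd_conj e) g b).
  rewrite !opprD !addrA [LHS]addrAC; congr (_ + _); exact: addrAC.
rewrite (S h c a) (S e _ a) (C b (cd_conj g)) (C (cd_mul (cd_conj g) b)).
rewrite (C b (cd_conj e)) (C (cd_mul (cd_conj e) b)) !A.
rewrite (C b (cd_conj c)) (S _ b) -!addrA; congr (_ + _).
by rewrite addrA addrC.
Qed.

(** The cross terms of the two components become, by adjunction, the inner products of b with e (a
    c) and with (e a) c. They cancel because the previous level is associative. *)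
Lemma cd_sqnormM k : (k <= 3)%N -> forall x y : cd R k,
  cd_sqnorm (cd_mul x y) = cd_sqnorm x * cd_sqnorm y.
Proof.
elim: k => [|k IHk] k3; first exact: exprMn.
move=> [a b] [c e] /=; have N := IHk (ltnW k3).
rewrite !cd_sqnormD !N !cd_sqnormN !N !cd_sqnorm_conj cd_dotNr.
rewrite [cd_dot (cd_mul a c) _]cd_dotC cd_dot_adjl cd_conjK cd_mulA//.
rewrite [cd_dot _ (cd_mul b _)]cd_dotC cd_dot_adjr cd_conjK; ring.
Qed.


End CayleyDickson.

(** * The Hermitian form *)

Section Hermitian.
Context {R : realType} {k : nat}.

Lemma imagE (v : imag R k) : cd_conj v = - (v : cd R k).
Proof. by have := imag_valP v; rewrite inE => /eqP{2}->; rewrite opprK. Qed.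

Lemma cd_dot1_imag (v : imag R k) : cd_dot (cd_one k) v = 0.
Proof.
have : cd_dot (cd_one k) v = - cd_dot (cd_one k) v.
  by rewrite -{1}cd_dot_conj cd_conj1 imagE cd_dotNr.
lra.
Qed.

Lemma imD (x y : cd R k) : im (x + y) = im x + im y.
Proof. by apply/val_inj; rewrite /= cd_conjD -scalerDr opprD addrACA. Qed.

Lemma imN (x : cd R k) : im (- x) = - im x.
Proof. by apply/val_inj; rewrite /= cd_conjN -scalerN opprB opprK addrC. Qed.

Definition herm m (z w : 'rV[cd R k]_m) : cd R k :=
  \sum_i cd_mul (cd_conj (z 0 i)) (w 0 i).

Definition vec_sqnorm m (z : 'rV[cd R k]_m) : R := \sum_i cd_sqnorm (z 0 i).

Context {m : nat}.
Implicit Types z w : 'rV[cd R k]_m.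

Lemma omegaE z w : omega z w = im (herm w z). Proof. by []. Qed.

Lemma hermDl z z' w : herm (z + z') w = herm z w + herm z' w.
Proof.
by rewrite /herm -big_split; apply: eq_bigr => i _; rewrite !mxE cd_conjD cd_mulDl.
Qed.

Lemma hermDr z z' w : herm w (z + z') = herm w z + herm w z'.
Proof.
by rewrite /herm -big_split; apply: eq_bigr => i _; rewrite !mxE cd_mulDr.
Qed.

Lemma hermNr z w : herm w (- z) = - herm w z.
Proof.
by rewrite /herm -sumrN; apply: eq_bigr => i _; rewrite !mxE cd_mulNr.
Qed.

Definition scalev (a : R) z : 'rV[cd R k]_m := map_mx ( *:%R a) z.

Lemma hermZ (a b : R) z w :
  herm (scalev a z) (scalev b w) = (a * b) *: herm z w.
Proof.
rewrite /herm scaler_sumr; apply: eq_bigr => i _.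
by rewrite !mxE cd_conjZ cd_mulZl cd_mulZr scalerA.
Qed.

Lemma herm_conj z w : cd_conj (herm z w) = herm w z.
Proof.
rewrite /herm (big_morph (@cd_conj R k) (@cd_conjD R k) (@cd_conj0 R k)).
by apply: eq_bigr => i _; rewrite cd_conjM cd_conjK.
Qed.

Lemma omegaDl z z' w : omega (z + z') w = omega z w + omega z' w.
Proof. by rewrite !omegaE hermDr imD. Qed.

Lemma omegaDr z z' w : omega w (z + z') = omega w z + omega w z'.
Proof. by rewrite !omegaE hermDl imD. Qed.

Lemma omegaNl z w : omega (- z) w = - omega z w.
Proof. by rewrite !omegaE hermNr imN. Qed.

Lemma omegazz z : omega z z = 0.
Proof.
by rewrite omegaE; apply/val_inj; rewrite /= herm_conj subrr scaler0.
Qed.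

Lemma vec_sqnorm_ge0 z : 0 <= vec_sqnorm z.
Proof. by apply: sumr_ge0 => i _; exact: cd_sqnorm_ge0. Qed.

Lemma vec_sqnorm_eq0 z : (vec_sqnorm z == 0) = (z == 0).
Proof.
rewrite /vec_sqnorm psumr_eq0 => [|i _]; last exact: cd_sqnorm_ge0.
apply/allP/eqP => [z0|-> i _]; last by rewrite mxE cd_sqnorm0/=.
apply/rowP => i; apply/eqP; rewrite mxE -cd_sqnorm_eq0.
by have := z0 i; rewrite mem_index_enum => /(_ isT).
Qed.

Lemma vec_sqnorm_dot z w (x : cd R k) :
  cd_dot x (herm z w) = \sum_i cd_dot x (cd_mul (cd_conj (z 0 i)) (w 0 i)).
Proof.
rewrite /herm (big_morph (cd_dot x) (id1 := 0) (op1 := +%R)) //.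
  by move=> y y'; rewrite cd_dotDr.
by rewrite -(scale0r (0 : cd R k)) cd_dotZr mul0r.
Qed.

Lemma vec_sqnormD z w : vec_sqnorm (z + w) =
  vec_sqnorm z + vec_sqnorm w + 2 * cd_dot (cd_one k) (herm z w).
Proof.
rewrite vec_sqnorm_dot mulr_sumr -!big_split; apply: eq_bigr => i _.
rewrite /= mxE cd_sqnormD [cd_dot (cd_one k) _]cd_dotC cd_dot_adjl.
by rewrite cd_conjK cd_mul1r (cd_dotC (w 0 i)).
Qed.

Lemma vec_sqnormN z : vec_sqnorm (- z) = vec_sqnorm z.
Proof. by apply: eq_bigr => i _; rewrite mxE cd_sqnormN. Qed.

Lemma vec_sqnormZ (a : R) z : vec_sqnorm (scalev a z) = a ^+ 2 * vec_sqnorm z.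
Proof.
by rewrite /vec_sqnorm mulr_sumr; apply: eq_bigr => i _; rewrite mxE cd_sqnormZ.
Qed.

Lemma cd_sqnorm_sum_le (F : 'I_m -> cd R k) :
  cd_sqnorm (\sum_i F i) <= 2 ^+ m * \sum_i cd_sqnorm (F i).
Proof.
elim: m F => [|j IHj] F; first by rewrite !big_ord0 cd_sqnorm0 mulr0.
rewrite !big_ord_recl (le_trans (cd_sqnormD_le _ _))// exprS -mulrA ler_wpM2l//.
rewrite mulrDr lerD ?IHj// ler_peMl ?cd_sqnorm_ge0// exprn_ege1//; lra.
Qed.

Hypothesis k3 : (k <= 3)%N.

(** Cauchy-Schwarz up to a constant: [2 ^+ m] comes from splitting the norm of a sum m times, [m%:R]
    from bounding each summand by the full product. *)
Lemma herm_le z w :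
  cd_sqnorm (herm z w) <= (2 ^+ m * m%:R) * (vec_sqnorm z * vec_sqnorm w).
Proof.
rewrite (le_trans (cd_sqnorm_sum_le _))// -mulrA ler_wpM2l ?exprn_ge0//.
have -> c : m%:R * c = \sum_(i < m) c :> R.
  by rewrite sumr_const card_ord mulr_natl.
apply: ler_sum => i _.
rewrite cd_sqnormM// cd_sqnorm_conj.
have le1 (u : 'rV[cd R k]_m) : cd_sqnorm (u 0 i) <= vec_sqnorm u.
  rewrite /vec_sqnorm (bigD1 i)//= ler_wpDr//.
  by apply: sumr_ge0 => j _; exact: cd_sqnorm_ge0.
by rewrite ler_pM ?cd_sqnorm_ge0.
Qed.

(** Polarizing the multiplicativity of the norm gives <xa, ya> = |a|^2 <x, y>. By adjunction the
    difference [u] of the two sides is then orthogonal to itself. *)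
Lemma cd_mulKr (x a : cd R k) :
  cd_mul (cd_mul x a) (cd_conj a) = cd_sqnorm a *: x.
Proof.
have pol (y : cd R k) :
    cd_dot (cd_mul x a) (cd_mul y a) = cd_sqnorm a * cd_dot x y.
  have := cd_sqnormM k3 (x + y) a.
  rewrite cd_mulDl !cd_sqnormD !cd_sqnormM//; lra.
apply/eqP; rewrite -subr_eq0 -cd_sqnorm_eq0 -cd_dotE.
set u := _ - _; rewrite {1}/u cd_dotDl cd_dotNl cd_dotZl -pol.
by rewrite (cd_dotC (cd_mul x a)) (cd_dot_adjr u a) (cd_dotC u) subrr.
Qed.

Definition rmulv z (a : cd R k) : 'rV[cd R k]_m := \row_i cd_mul (z 0 i) a.

Lemma vec_sqnorm_rmulv z a :
  vec_sqnorm (rmulv z a) = vec_sqnorm z * cd_sqnorm a.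
Proof.
by rewrite /vec_sqnorm mulr_suml; apply: eq_bigr => i _; rewrite mxE cd_sqnormM.
Qed.

Lemma rmulvZ z (t : R) a : rmulv z (t *: a) = scalev t (rmulv z a).
Proof. by apply/rowP => i; rewrite !mxE cd_mulZr. Qed.

(* For the octonions the identity holds only in dimension one, where it is the
   multiplicativity of the norm. *)
Lemma cd_sqnorm_herm_rmulv z w a b : (k <= 2)%N || (m == 1)%N ->
  cd_sqnorm (herm (rmulv z a) (rmulv w b)) =
  cd_sqnorm a * cd_sqnorm b * cd_sqnorm (herm z w).
Proof.
case/orP => [k2|/eqP m1].
  have -> : herm (rmulv z a) (rmulv w b) =
      cd_mul (cd_conj a) (cd_mul (herm z w) b).
    rewrite /herm (big_morph (fun x => cd_mul x b) (id1 := 0) (op1 := +%R));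
      last 2 first.
    - by move=> x y; rewrite cd_mulDl.
    - exact: cd_mul0l.
    rewrite (big_morph (cd_mul (cd_conj a)) (id1 := 0) (op1 := +%R));
      last 2 first.
    - by move=> x y; rewrite cd_mulDr.
    - exact: cd_mul0r.
    by apply: eq_bigr => i _; rewrite !mxE cd_conjM !cd_mulA.
  by rewrite !cd_sqnormM// cd_sqnorm_conj; ring.
have [i0 sumE] : exists i0 : 'I_m, forall F : 'I_m -> cd R k, \sum_i F i = F i0.
  by rewrite m1; exists ord0 => F; rewrite big_ord1.
rewrite /herm !sumE !mxE !cd_sqnormM// !cd_sqnorm_conj !cd_sqnormM//; ring.
Qed.

(** Pairing with conj(a) lets [cd_mulKr] cancel a in each coordinate, so the identity survives
    without associativity and in every dimension. *)
Lemma cd_dot_herm_rmulvl z w a b :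
  cd_dot (cd_conj a) (herm (rmulv z a) (rmulv w b)) =
  cd_sqnorm a * cd_dot (cd_conj b) (herm z w).
Proof.
rewrite !vec_sqnorm_dot mulr_sumr; apply: eq_bigr => i _.
rewrite !mxE cd_dotC cd_dot_adjl cd_conjK cd_mulKr cd_dotZr; congr (_ * _).
by rewrite cd_dot_conjl cd_conjM cd_conjK cd_dot_adjl.
Qed.

Lemma cd_dot_herm_rmulvr z w a b :
  cd_dot b (herm (rmulv z a) (rmulv w b)) =
  cd_sqnorm b * cd_dot a (herm z w).
Proof.
rewrite -cd_dot_conj herm_conj cd_dot_herm_rmulvl.
by rewrite -[herm w z]herm_conj cd_dot_conj.
Qed.

(** The core of the distance formula for the inversion. If a and b are the coefficients [heis_coef]
    of p and q, then a + conj(b) - 2 <z, w> is the coefficient of q^-1 p, and the element on the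
    left is that of (Iq)^-1 (Ip) up to a real factor. Expanding both squared norms leaves only terms
    covered by the three preceding lemmas. *)
Lemma cd_sqnorm_inversion z w a b : (k <= 2)%N || (m == 1)%N ->
  cd_sqnorm (cd_sqnorm b *: cd_conj a + cd_sqnorm a *: b
             - 2 *: herm (rmulv z a) (rmulv w b)) =
  cd_sqnorm a * cd_sqnorm b * cd_sqnorm (a + cd_conj b - 2 *: herm z w).
Proof.
move=> kn.
rewrite !cd_sqnormD !cd_sqnormN !cd_sqnormZ !cd_sqnorm_conj.
rewrite !(cd_dotNr, cd_dotZr, cd_dotDl, cd_dotZl).
rewrite cd_dot_herm_rmulvl cd_dot_herm_rmulvr cd_sqnorm_herm_rmulv//.
rewrite (cd_dot_conjl a b); ring.
Qed.

End Hermitian.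

(** * The Heisenberg group and its inversion *)

Section Heisenberg.
Context {R : realType} {k n : nat}.
Implicit Types p q r : heis R k n.

Local Notation o := (heis_origin R k n).

Lemma im_id (v : cd R k) : cd_conj v = - v -> im v = v :> cd R k.
Proof.
move=> vE; rewrite /= vE opprK -[in LHS](scale1r v) -scalerDl scalerA.
by rewrite (_ : _ * _ = 1) ?scale1r//; lra.
Qed.

Definition imagZ (a : R) (v : imag R k) : imag R k := im (a *: (v : cd R k)).

Lemma imagZE a (v : imag R k) : imagZ a v = a *: (v : cd R k) :> cd R k.
Proof. by apply: im_id; rewrite cd_conjZ imagE scalerN. Qed.

Lemma imag_valN (v : imag R k) : (- v : imag R k) = - (v : cd R k) :> cd R k.
Proof. by []. Qed.

Lemma heis_eq p q : p.1 = q.1 -> p.2 = q.2 :> cd R k -> p = q.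
Proof. by case: p q => [z v] [w u] /= -> /val_inj ->. Qed.

Lemma heis_mulA : associative (@heis_mul R k n).
Proof.
move=> p q r; congr (_, _); rewrite /=; first exact: addrA.
rewrite omegaDl omegaDr !mulr2n !addrA.
by rewrite [LHS](ACl (1*2*6*8*3*7*4*9*5)%AC).
Qed.

Lemma heis_mul1p p : heis_mul o p = p.
Proof.
case: p => z v; rewrite /heis_mul /= add0r omegaE.
suff -> : herm z 0 = 0 by rewrite add0r (_ : im 0 = 0) ?mul0rn ?addr0//;
  apply/val_inj; rewrite /= cd_conj0 subrr scaler0.
by rewrite -(subrr z) hermDr hermNr subrr.
Qed.

Lemma heis_mulVp p : heis_mul (heis_inv p) p = o.
Proof.
by case: p => z v; rewrite /heis_mul /= !addNr omegaNl omegazz oppr0 mul0rn addr0.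
Qed.

Lemma heis_invK : involutive (@heis_inv R k n).
Proof. by case=> z v; rewrite /heis_inv /= !opprK. Qed.

Lemma heis_mulpV p : heis_mul p (heis_inv p) = o.
Proof. by rewrite -{1}(heis_invK p) heis_mulVp. Qed.

Lemma heis_mulp1 p : heis_mul p o = p.
Proof. by rewrite -(heis_mulVp p) heis_mulA heis_mulpV heis_mul1p. Qed.

Lemma heis_mulK p q : heis_mul (heis_inv p) (heis_mul p q) = q.
Proof. by rewrite heis_mulA heis_mulVp heis_mul1p. Qed.

Lemma heis_mulKV p q : heis_mul p (heis_mul (heis_inv p) q) = q.
Proof. by rewrite heis_mulA heis_mulpV heis_mul1p. Qed.

Lemma heis_mul_inj p : injective (heis_mul p).
Proof. exact: (can_inj (heis_mulK p)). Qed.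

Lemma heis_invM p q :
  heis_inv (heis_mul p q) = heis_mul (heis_inv q) (heis_inv p).
Proof.
apply: (@heis_mul_inj (heis_mul p q)).
by rewrite heis_mulpV -heis_mulA heis_mulKV heis_mulpV.
Qed.

(** The element |zeta|^2 + v. Its norm is the square of the Koranyi gauge, so [rho] below is the
    fourth power of the gauge and avoids roots. *)
Definition heis_coef p : cd R k := vec_sqnorm p.1 *: cd_one k + (p.2 : cd R k).

Lemma heis_coefV p : heis_coef (heis_inv p) = cd_conj (heis_coef p).
Proof.
by rewrite /heis_coef /= vec_sqnormN cd_conjD cd_conjZ cd_conj1 imagE.
Qed.

Lemma imZ a (x : cd R k) : im (a *: x) = a *: (im x : cd R k) :> cd R k.
Proof. by rewrite /= cd_conjZ -scalerBr !scalerA mulrC. Qed.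

Lemma heis_mul2E p q : (heis_mul p q).2 =
  (p.2 : cd R k) + (q.2 : cd R k) + 2 *: (im (herm q.1 p.1) : cd R k) :> cd R k.
Proof. by rewrite scaler_nat. Qed.

(** The real part of 2 [herm] comes from expanding the norm of zeta + zeta', its imaginary part from
    the term 2 omega of the group law. *)
Lemma heis_coefM p q : heis_coef (heis_mul p q) =
  heis_coef p + heis_coef q + 2 *: herm q.1 p.1.
Proof.
rewrite /heis_coef vec_sqnormD heis_mul2E cd_imE.
rewrite -[herm p.1 q.1]herm_conj -cd_dot_conjl cd_conj1.
set h := herm _ _; rewrite 2!scalerDl -scalerA.
set x := (cd_dot _ _ *: _); rewrite scalerBr !addrA.
rewrite [LHS](ACl ((1*4)*(2*5)*6*(3*7))%AC) /=.
by rewrite subrr addr0 !addrA.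
Qed.

Definition rho p : R := cd_sqnorm (heis_coef p).

Lemma rhoE p : rho p = vec_sqnorm p.1 ^+ 2 + cd_sqnorm (p.2 : cd R k).
Proof.
rewrite /rho cd_sqnormD cd_sqnormZ cd_sqnorm1 mulr1 cd_dotZl cd_dot1_imag.
by rewrite !mulr0 addr0.
Qed.

Lemma koranyi_gaugeE p : koranyi_gauge p = rho p `^ 4^-1.
Proof.
rewrite /koranyi_gauge rhoE; congr ((_ + _) `^ _).
  rewrite -[4%N]/(2 * 2)%N exprM /vec_norm sqr_sqrtr.
    by congr (_ ^+ 2); apply: eq_bigr => i _; rewrite sqr_sqrtr ?cd_sqnorm_ge0.
  by apply: sumr_ge0 => i _; exact: sqr_ge0.
by rewrite sqr_sqrtr ?cd_sqnorm_ge0.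
Qed.

Lemma rho_ge0 p : 0 <= rho p. Proof. exact: cd_sqnorm_ge0. Qed.

Lemma rho_eq0 p : (rho p == 0) = (p == o).
Proof.
rewrite rhoE paddr_eq0 ?sqr_ge0 ?cd_sqnorm_ge0// sqrf_eq0 vec_sqnorm_eq0.
by rewrite cd_sqnorm_eq0; case: p.
Qed.

Lemma rho_gt0 p : p != o -> 0 < rho p.
Proof. by rewrite -rho_eq0 lt_neqAle rho_ge0 andbT eq_sym. Qed.

Lemma rho_origin : rho o = 0. Proof. by apply/eqP; rewrite rho_eq0. Qed.

Lemma rhoV p : rho (heis_inv p) = rho p.
Proof. by rewrite /rho heis_coefV cd_sqnorm_conj. Qed.

Hypothesis k3 : (k <= 3)%N.

(** The first 4 comes from using |x + y|^2 <= 2 (|x|^2 + |y|^2) twice. The Hermitian term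
    contributes 2 |2 herm|^2, that is 8 |herm|^2; [herm_le] and the arithmetic-geometric mean
    inequality reduce 8 to 4. *)
Definition rho_const : R := 4 + 4 * (2 ^+ n.-1 * n.-1%:R).

Lemma rho_constP : 1 <= rho_const.
Proof.
rewrite /rho_const; have : 0 <= (2 ^+ n.-1 * n.-1%:R) :> R by rewrite mulr_ge0.
lra.
Qed.

Lemma rho_mul_le p q : rho (heis_mul p q) <= rho_const * (rho p + rho q).
Proof.
rewrite {1}/rho heis_coefM.
have := cd_sqnormD_le (heis_coef p + heis_coef q) (2 *: herm q.1 p.1).
have := cd_sqnormD_le (heis_coef p) (heis_coef q).
rewrite -/(rho p) -/(rho q) cd_sqnormZ.
have := herm_le k3 q.1 p.1; set c := (2 ^+ _ * _).
have -> : rho_const = 4 + 4 * c by [].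
have c0 : 0 <= c by rewrite mulr_ge0// exprn_ge0.
have /(ler_wpM2l c0) :
    vec_sqnorm q.1 * vec_sqnorm p.1 <= 2^-1 * (rho p + rho q).
  have := cd_sqnorm_ge0 (p.2 : cd R k); have := cd_sqnorm_ge0 (q.2 : cd R k).
  have := sqr_ge0 (vec_sqnorm p.1 - vec_sqnorm q.1); rewrite sqrrB.
  rewrite !rhoE; lra.
lra.
Qed.

Definition heis_dil (t : R) p : heis R k n :=
  (scalev t p.1, imagZ (t ^+ 2) p.2).

Lemma heis_dil_snd t p : (heis_dil t p).2 = t ^+ 2 *: (p.2 : cd R k) :> cd R k.
Proof. exact: imagZE. Qed.

Lemma heis_coef_dil t p : heis_coef (heis_dil t p) = t ^+ 2 *: heis_coef p.
Proof.
rewrite /heis_coef [vec_sqnorm _]vec_sqnormZ -scalerA scalerDr.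
by congr (_ + _); exact: imagZE.
Qed.

Lemma rho_dil t p : rho (heis_dil t p) = t ^+ 4 * rho p.
Proof. by rewrite /rho heis_coef_dil cd_sqnormZ -exprM. Qed.

Lemma heis_dilM t p q :
  heis_dil t (heis_mul p q) = heis_mul (heis_dil t p) (heis_dil t q).
Proof.
apply: heis_eq; first by apply/rowP => i; rewrite !mxE scalerDr.
rewrite heis_dil_snd !heis_mul2E !heis_dil_snd [herm _ _ in RHS]hermZ imZ -expr2.
by rewrite !scalerDr !scalerA (mulrC 2).
Qed.

Lemma heis_dilV t p : heis_dil t (heis_inv p) = heis_inv (heis_dil t p).
Proof.
apply: heis_eq; first by apply/rowP => i; rewrite !mxE scalerN.
by rewrite [RHS]imag_valN !heis_dil_snd imag_valN scalerN.
Qed.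

Lemma heis_dil_dil s t p : heis_dil s (heis_dil t p) = heis_dil (s * t) p.
Proof.
apply: heis_eq; first by apply/rowP => i; rewrite !mxE scalerA.
by rewrite !heis_dil_snd scalerA exprMn.
Qed.

Lemma heis_dil1 p : heis_dil 1 p = p.
Proof.
apply: heis_eq; first by apply/rowP => i; rewrite !mxE scale1r.
by rewrite imagZE expr1n scale1r.
Qed.

Lemma heis_dil_origin t : heis_dil t o = o.
Proof. by apply/eqP; rewrite -rho_eq0 rho_dil rho_origin mulr0. Qed.

Lemma heis_dil_eq1 t p : t != 0 -> (heis_dil t p == o) = (p == o).
Proof. by move=> t0; rewrite -!rho_eq0 rho_dil mulf_eq0 expf_eq0 (negbTE t0). Qed.

Definition vertical (v : imag R k) : heis R k n := (0, v).

Lemma verticalD u v : vertical (u + v) = heis_mul (vertical u) (vertical v).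
Proof. by rewrite /heis_mul /= omegazz mul0rn !addr0. Qed.

(** The dilation doubles zeta but multiplies v by 4, so two factors p^-1 cancel zeta and leave 2v.
    All horizontal parts are multiples of zeta, hence [omega] vanishes. *)
Lemma heis_dil2 p :
  heis_mul (heis_inv p) (heis_mul (heis_inv p) (heis_dil 2 p)) =
  vertical (p.2 + p.2).
Proof.
have E : scalev 2 p.1 = p.1 + p.1.
  by apply/rowP => i; rewrite !mxE scaler_nat mulr2n.
have E2 : imagZ (2 ^+ 2) p.2 = p.2 + p.2 + (p.2 + p.2).
  apply/val_inj; rewrite [LHS]imagZE /=.
  by rewrite -natrX scaler_nat -[(2 ^ 2)%N]/(2 + 2)%N mulrnDr.
rewrite heis_mulA /heis_mul /= E E2 omegazz mul0rn addr0.
by rewrite -!opprD omegaNl omegazz oppr0 mul0rn addr0 addNr addKr.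
Qed.

Lemma heis_dil2_vertical v : heis_dil 2 (vertical v) =
  vertical (v + v + (v + v)).
Proof.
apply: heis_eq; first by apply/rowP => i; rewrite !mxE scaler0.
by rewrite imagZE -natrX scaler_nat -[(2 ^ 2)%N]/(2 + 2)%N mulrnDr.
Qed.

(** The Koranyi inversion: zeta is multiplied on the right by the inverse of conj(|zeta|^2 + v), and
    v is divided by [- rho p]. At the origin the convention 0^-1 = 0 gives the default value [o];
    [bdry_swap] treats that point separately. *)
Definition heis_inversion p : heis R k n :=
  (rmulv p.1 ((rho p)^-1 *: heis_coef p), imagZ (- (rho p)^-1) p.2).

Lemma heis_inversion_fst p :
  (heis_inversion p).1 = scalev (rho p)^-1 (rmulv p.1 (heis_coef p)).
Proof. by rewrite -rmulvZ. Qed.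

Lemma heis_coef_inversion p : p != o ->
  heis_coef (heis_inversion p) = (rho p)^-1 *: cd_conj (heis_coef p).
Proof.
move=> p0; have r0 : rho p != 0 by rewrite rho_eq0.
rewrite /heis_coef [X in vec_sqnorm X]/= [X in _ + X]imagZE.
rewrite vec_sqnorm_rmulv// cd_sqnormZ -/(rho p) cd_conjD cd_conjZ cd_conj1 imagE.
rewrite scalerDr scalerA scaleNr scalerN; congr (_ *: _ - _).
by rewrite -/(rho p); field.
Qed.

Lemma rho_inversion p : p != o -> rho (heis_inversion p) = (rho p)^-1.
Proof.
move=> p0; have r0 : rho p != 0 by rewrite rho_eq0.
rewrite /rho heis_coef_inversion// cd_sqnormZ cd_sqnorm_conj -/(rho p).
by field.
Qed.

Lemma heis_inversion_neq1 p : p != o -> heis_inversion p != o.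
Proof. by move=> p0; rewrite -rho_eq0 rho_inversion// invr_eq0 rho_eq0. Qed.

Lemma heis_inversionK p : p != o -> heis_inversion (heis_inversion p) = p.
Proof.
move=> p0; have r0 : rho p != 0 by rewrite rho_eq0.
have E : (rho (heis_inversion p))^-1 *: heis_coef (heis_inversion p) =
    cd_conj (heis_coef p).
  by rewrite heis_coef_inversion// rho_inversion// scalerA invrK mulfV// scale1r.
apply: heis_eq; last first.
  rewrite imagZE rho_inversion// [heis_inversion p]/heis_inversion.
  by rewrite imagZE scalerA invrK mulrNN mulfV// scale1r.
rewrite {1}/heis_inversion [LHS]/= E rmulvZ.
apply/rowP => i; rewrite !mxE cd_mulZl cd_mulKr// scalerA -/(rho p).
by rewrite mulVf// scale1r.
Qed.

Hypothesis kn : (k <= 2)%N || (n.-1 == 1)%N.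

Lemma rho_inversion_dist p q : p != o -> q != o ->
  rho (heis_mul (heis_inv (heis_inversion q)) (heis_inversion p)) =
  rho (heis_mul (heis_inv q) p) / (rho p * rho q).
Proof.
move=> p0 q0; have r0 : rho p != 0 by rewrite rho_eq0.
have s0 : rho q != 0 by rewrite rho_eq0.
have := cd_sqnorm_inversion k3 p.1 q.1 (heis_coef p) (heis_coef q) kn.
rewrite -/(rho p) -/(rho q) => E.
rewrite [in RHS]/rho heis_coefM [heis_coef (heis_inv q)]heis_coefV.
rewrite [herm _ (heis_inv q).1]hermNr scalerN (addrC (cd_conj _)).
rewrite -(mulKf (mulf_neq0 r0 s0) (cd_sqnorm _)) -E.
rewrite {1}/rho heis_coefM heis_coefV !heis_coef_inversion// cd_conjZ cd_conjK.
rewrite [(heis_inv _).1]/(- _) hermNr !heis_inversion_fst hermZ.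
set h := herm _ _.
have -> : (rho q)^-1 *: heis_coef q + (rho p)^-1 *: cd_conj (heis_coef p) +
    2 *: - (((rho p)^-1 * (rho q)^-1) *: h) =
   ((rho p)^-1 * (rho q)^-1) *: (rho q *: cd_conj (heis_coef p) +
    rho p *: heis_coef q - 2 *: h).
  move: (cd_conj _) (heis_coef q) => a b.
  rewrite !scalerDr !scalerN !scalerA mulfVK// mulrAC mulVf// mul1r (mulrC 2).
  by rewrite (addrC (_ *: b)).
rewrite cd_sqnormZ -/(rho p) -/(rho q); field; exact/andP.
Qed.

Lemma heis_inversion_horizontal p : p.2 = 0 -> p != o ->
  heis_inversion p = heis_dil (vec_sqnorm p.1)^-1 p.
Proof.
move=> v0 p0; have r0 : rho p != 0 by rewrite rho_eq0.
have rE : rho p = vec_sqnorm p.1 ^+ 2 by rewrite rhoE v0 cd_sqnorm0 addr0.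
apply: heis_eq; last first.
  by rewrite !imagZE v0 !scaler0.
apply/rowP => i; rewrite !mxE /heis_coef v0 addr0 cd_mulZr cd_mulZr cd_mul1r.
rewrite scalerA rE; congr (_ *: _); field.
by move: r0; rewrite rE expf_eq0.
Qed.

Lemma heis_inversion_vertical p : p.1 = 0 -> p != o ->
  heis_inversion p = heis_inv (heis_dil (Num.sqrt (rho p))^-1 p).
Proof.
move=> z0 p0; apply: heis_eq.
  apply/rowP => i; rewrite !mxE z0 !mxE scaler0 oppr0 cd_mul0l//.
rewrite [LHS]imagZE [RHS]imag_valN heis_dil_snd scaleNr; congr (- (_ *: _)).
by rewrite exprVn sqr_sqrtr ?rho_ge0.
Qed.

End Heisenberg.

(** * Moebius transformations of the Koranyi metric *)

Section CrossRatio.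
Context {R : realType} {k n : nat}.
Implicit Types d : heis R k n -> heis R k n -> R.

Lemma bdry_continuousP d (f : bdry d -> bdry d) :
  continuous f <-> forall U : set (bdry d), bdry_open U -> bdry_open (f @^-1` U).
Proof. exact: continuousP. Qed.

Lemma cr_factor_neq0 d x y : (forall p q, d p q = 0 -> p = q) ->
  x != y -> cr_factor d x y != 0.
Proof.
move=> d0; case: x y => [p|] [q|] //= pq; rewrite ?oner_neq0//.
by apply: contraNneq pq => /d0 ->.
Qed.

(** Each of the four points occurs once in a numerator and once in a denominator, so the weights
    cancel. Infinity carries a weight like any other point, since its factors are set to 1. *)
Lemma cross_ratio_weight d (f : option (heis R k n) -> option (heis R k n))
    (w : option (heis R k n) -> R) :
  (forall p q, d p q = 0 -> p = q) -> (forall x, w x != 0) ->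
  (forall x y, x != y -> cr_factor d (f x) (f y) = w x * w y * cr_factor d x y) ->
  forall p1 p2 p3 p4 : option (heis R k n), uniq [:: p1; p2; p3; p4] ->
    cross_ratio d (f p1) (f p2) (f p3) (f p4) = cross_ratio d p1 p2 p3 p4.
Proof.
move=> d0 w0 fE p1 p2 p3 p4 /=; rewrite !inE !negb_or -!andbA.
case/and5P => p12 p13 p14 p23 /and3P[p24 p34 _].
rewrite /cross_ratio !fE// 1?eq_sym//.
have a := cr_factor_neq0 d0 (_ : p4 != p1).
have b := cr_factor_neq0 d0 (_ : p3 != p2).
field; rewrite !w0 ?a ?b//; by rewrite eq_sym.
Qed.

End CrossRatio.

Lemma ltr_exp4 (F : realFieldType) (x y : F) : 0 <= x -> 0 <= y ->
  (x ^+ 4 < y ^+ 4) = (x < y).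
Proof. by move=> x0 y0; rewrite ltr_pXn2r. Qed.

(** Continuity of the inversion at p, near q: P, y and x are the fourth powers of D(o,p), D(o,q) and
    D(p,q), c is the quasi-triangle constant and s the fourth power of the target radius. The first
    bound on x keeps q away from o, the second then controls x / (P y), the fourth power of the
    distance of the images. *)
Lemma inversion_estimate (F : realFieldType) (c s P x y : F) :
  0 < c -> 0 < s -> 0 < P -> P <= c * (y + x) -> x * (2 * c) < P ->
  x * (2 * c) < s * P ^+ 2 -> 0 < y /\ x < s * (P * y).
Proof.
move=> c0 s0 P0 H1 H2 H3.
have H4 : P < 2 * c * y by lra.
have y0 : 0 < y by rewrite -(pmulr_rgt0 _ c0); lra.
split=> //; rewrite -(ltr_pM2r (mulr_gt0 (ltr0Sn F 1) c0)) (lt_trans H3)//.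
rewrite -!mulrA ltr_pM2l// expr2 ltr_pM2l//; lra.
Qed.

Lemma powR_root4 (R : realType) (e : R) : 0 <= e -> (e `^ 4^-1) ^+ 4 = e.
Proof.
move=> e0; rewrite -powR_mulrn ?powR_ge0// -powRrM.
by rewrite mulVf ?pnatr_eq0// powRr1.
Qed.

(** * Similarities and inversions as Moebius maps of a quasi-metric *)

Section QuasiMetric.
Context {R : realType} {k n : nat}.
Implicit Types p q r : heis R k n.
Local Notation o := (heis_origin R k n).
Variables (D : heis R k n -> heis R k n -> R) (c : R).
Hypothesis c0 : 0 < c.
Hypothesis D_ge0 : forall p q, 0 <= D p q.
Hypothesis D_eq0 : forall p q, D p q = 0 -> p = q.
Hypothesis Dxx : forall p, D p p = 0.
Hypothesis DC : forall p q, D p q = D q p.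
Hypothesis D_quasi : forall p q r, D p r ^+ 4 <= c * (D p q ^+ 4 + D q r ^+ 4).

Let D_gt0 p q : p != q -> 0 < D p q.
Proof.
move=> pq; rewrite lt_neqAle D_ge0 andbT eq_sym.
by apply: contra_neq pq; exact: D_eq0.
Qed.

Lemma similarity_continuous (g : heis R k n -> heis R k n) (s : R) : 0 < s ->
  (forall p q, D (g p) (g q) = s * D p q) ->
  continuous (omap g : bdry D -> bdry D).
Proof.
move=> s0 gE; apply/bdry_continuousP => U [U1 U2]; split=> [p /= /U1|/= /U2].
  move=> [r r0 rU]; exists (r / s); first exact: divr_gt0.
  by move=> q pq; apply: rU; rewrite gE mulrC -ltr_pdivlMr.
move=> [r r0 rU].
(* Chosen so that D(o,q)^4 > e makes D(g o, g q)^4 exceed c (D(g o, o)^4 + r^4); the quasi-triangle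
   inequality through o then forces D(o, g q) > r. *)
pose e := (c * (D (g o) o ^+ 4 + r ^+ 4)) / s ^+ 4.
have e0 : 0 < e.
  rewrite divr_gt0 ?exprn_gt0// mulr_gt0 ?c0//.
  by rewrite ltr_wpDl ?exprn_ge0 ?D_ge0// exprn_gt0.
exists (e `^ 4^-1); first exact: powR_gt0.
move=> q; rewrite -(ltr_exp4 (powR_ge0 _ _) (D_ge0 _ _)).
rewrite (powR_root4 (ltW e0)).
rewrite ltr_pdivrMr ?exprn_gt0// [ltRHS]mulrC -exprMn -gE => H.
apply: rU; rewrite -(ltr_exp4 (ltW r0) (D_ge0 _ _)).
have := lt_le_trans H (D_quasi (g o) o (g q)).
by rewrite ltr_pM2l ?c0// ltrD2l.
Qed.

Lemma similarity_moebius (g g' : heis R k n -> heis R k n) (s : R) : 0 < s ->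
  cancel g g' -> cancel g' g ->
  (forall p q, D (g p) (g q) = s * D p q) -> moebius D (omap g).
Proof.
move=> s0 gK g'K gE; split.
  split; first exact: (similarity_continuous s0).
  exists (omap g'); split.
  - by case=> //= p; rewrite gK.
  - by case=> //= p; rewrite g'K.
  have s'0 : 0 < s^-1 by rewrite invr_gt0.
  apply: (similarity_continuous s'0) => p q.
  by rewrite -{2}(g'K p) -{2}(g'K q) gE mulKf// gt_eqF.
(* A pair of finite points must scale by s and a pair containing infinity by 1: hence the weights
   sqrt(s) and 1 / sqrt(s). *)
apply: (cross_ratio_weight
  (w := fun x => if x is Some _ then Num.sqrt s else (Num.sqrt s)^-1)).
- exact: D_eq0.
- by case=> [_|]; rewrite ?invr_eq0 gt_eqF// sqrtr_gt0.
- have r0 : Num.sqrt s != 0 by rewrite gt_eqF// sqrtr_gt0.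
  case=> [p|] [q|] //= _; rewrite ?mulr1 ?mulfV ?mulVf//.
  by rewrite gE -expr2 sqr_sqrtr// ltW.
Qed.

Variable inv : heis R k n -> heis R k n.
Hypothesis inv_neq1 : forall p, p != o -> inv p != o.
Hypothesis invK : forall p, p != o -> inv (inv p) = p.
Hypothesis D_inversion : forall p q, p != o -> q != o ->
  D (inv p) (inv q) = (D o p)^-1 * (D o q)^-1 * D p q.
Hypothesis D_inversion_origin : forall p, p != o -> D o (inv p) = (D o p)^-1.

Definition bdry_swap (x : option (heis R k n)) : option (heis R k n) :=
  if x is Some p then
    if p == o then None else Some (inv p)
  else Some o.

Lemma bdry_swapK : involutive bdry_swap.
Proof.
case=> [p|] /=; last by rewrite eqxx.
case: ifPn => [/eqP -> //|p0] /=.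
by rewrite (negbTE (inv_neq1 p0)) invK.
Qed.

Lemma bdry_swap_continuous : continuous (bdry_swap : bdry D -> bdry D).
Proof.
apply/bdry_continuousP => U [U1 U2]; split=> [p /=|/= /U1].
  case: ifPn => [/eqP -> UN|p0 /U1[r r0 rU]].
    have [r r0 rU] := U2 UN; exists r^-1; first by rewrite invr_gt0.
    move=> q /=; case: ifPn => [//|q0 oq].
    apply: rU; rewrite D_inversion_origin//.
    by rewrite -(invrK r) ltf_pV2 ?posrE ?invr_gt0// D_gt0// eq_sym.
  pose P := D o p ^+ 4.
  have P0 : 0 < P by rewrite exprn_gt0// D_gt0// eq_sym.
  pose e := Num.min (P / (2 * c)) (r ^+ 4 * P ^+ 2 / (2 * c)).
  have e0 : 0 < e.
    rewrite lt_min; apply/andP; split; apply: divr_gt0;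
      by rewrite ?mulr_gt0 ?exprn_gt0// D_gt0// eq_sym.
  exists (e `^ 4^-1); first exact: powR_gt0.
  move=> q; rewrite -(ltr_exp4 (D_ge0 _ _) (powR_ge0 _ _)).
  rewrite (powR_root4 (ltW e0)).
  rewrite lt_min !ltr_pdivlMr ?mulr_gt0// => /andP[H1 H2].
  have := D_quasi o q p; rewrite -/P (DC q) => H3.
  have [Q0 H] := inversion_estimate c0 (exprn_gt0 4 r0) P0 H3 H1 H2.
  have q0 : q != o.
    by apply: contraTneq Q0 => ->; rewrite Dxx expr0n ltxx.
  rewrite /= (negbTE q0); apply: rU; rewrite -(ltr_exp4 (D_ge0 _ _) (ltW r0)).
  rewrite D_inversion//.
  rewrite !exprMn !exprVn -/P -invfM mulrC ltr_pdivrMr//.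
  by apply: mulr_gt0.
move=> [r r0 rU]; exists r^-1; first by rewrite invr_gt0.
move=> q oq; have q0 : q != o.
  by apply: contraTneq oq => ->; rewrite Dxx -leNgt invr_ge0 ltW.
rewrite /= (negbTE q0); apply: rU; rewrite D_inversion_origin//.
by rewrite -(invrK r) ltf_pV2 ?posrE ?invr_gt0// D_gt0// eq_sym.
Qed.

Lemma bdry_swap_moebius : moebius D bdry_swap.
Proof.
split.
  split; first exact: bdry_swap_continuous.
  exists bdry_swap; split; [exact: bdry_swapK|exact: bdry_swapK|].
  exact: bdry_swap_continuous.
apply: (cross_ratio_weight (w := fun x => if x is Some p then
  if p == o then 1 else (D o p)^-1 else 1)).
- exact: D_eq0.
- case=> [p|]; rewrite ?oner_neq0//; case: ifPn => p0; rewrite ?oner_neq0//.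
  by rewrite invr_eq0 gt_eqF// D_gt0// eq_sym.
- have D0 p : p != o -> D o p != 0.
    by move=> p0; rewrite gt_eqF// D_gt0// eq_sym.
  case=> [p|] [q|] //= pq.
  + case: ifPn => [/eqP p0|p0]; case: ifPn => [/eqP q0|q0] /=.
    * by move: pq; rewrite p0 q0 eqxx.
    * by rewrite p0 mul1r mulVf// D0.
    * by rewrite q0 mulr1 (DC p) mulVf// D0.
    * by rewrite D_inversion.
  + case: ifPn => //= p0; rewrite ?mulr1//.
    by rewrite DC D_inversion_origin.
  + case: ifPn => //= q0; rewrite ?mulr1 ?mul1r//.
    by rewrite D_inversion_origin.
Qed.

End QuasiMetric.

(** * The Koranyi distance: translations, dilations and the inversion *)

Section Koranyi.
Context {R : realType} {k n : nat}.
Implicit Types p q r : heis R k n.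
Local Notation o := (heis_origin R k n).
Local Notation D := (@koranyi_dist R k n).

Lemma koranyi_dist_ge0 p q : 0 <= D p q.
Proof. exact: powR_ge0. Qed.

Lemma koranyi_dist4 p q : D p q ^+ 4 = rho (heis_mul (heis_inv q) p).
Proof.
by rewrite /koranyi_dist koranyi_gaugeE powR_root4 ?rho_ge0.
Qed.

Lemma koranyi_dist_eq p q p' q' (s : R) : 0 <= s ->
  rho (heis_mul (heis_inv q) p) = s ^+ 4 * rho (heis_mul (heis_inv q') p') ->
  D p q = s * D p' q'.
Proof.
move=> s0; rewrite -!koranyi_dist4 -exprMn => /eqP.
by rewrite eqrXn2 ?mulr_ge0 ?koranyi_dist_ge0// => /eqP.
Qed.

Lemma koranyi_distC p q : D p q = D q p.
Proof.
rewrite -[RHS]mul1r; apply: koranyi_dist_eq => //.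
by rewrite expr1n mul1r -rhoV heis_invM heis_invK.
Qed.

Lemma koranyi_dist_eq0 p q : D p q = 0 -> p = q.
Proof.
move=> /(congr1 (fun x => x ^+ 4)); rewrite koranyi_dist4 expr0n /= => /eqP.
rewrite rho_eq0 => /eqP E; rewrite -[RHS](heis_mulp1) -E heis_mulKV//.
Qed.

Lemma koranyi_distxx p : D p p = 0.
Proof.
have := koranyi_dist4 p p; rewrite heis_mulVp rho_origin => /eqP.
by rewrite expf_eq0 => /andP[_ /eqP].
Qed.

Lemma koranyi_dist_gt0 p q : p != q -> 0 < D p q.
Proof.
move=> pq; rewrite lt_neqAle koranyi_dist_ge0 andbT eq_sym.
by apply: contra_neq pq; exact: koranyi_dist_eq0.
Qed.

Lemma rho_dist_origin p : rho p = D o p ^+ 4.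
Proof. by rewrite koranyi_dist4 heis_mulp1 rhoV. Qed.

Hypothesis k3 : (k <= 3)%N.
Local Notation c := (@rho_const R n).

Lemma koranyi_quasi_triangle p q r :
  D p r ^+ 4 <= c * (D p q ^+ 4 + D q r ^+ 4).
Proof.
rewrite (koranyi_dist4 p r) (koranyi_dist4 p q) (koranyi_dist4 q r).
rewrite [X in _ <= c * X]addrC.
by rewrite -{1}(heis_mulKV q p) heis_mulA; apply: rho_mul_le.
Qed.

Lemma rho_const_gt0 : 0 < c. Proof. exact: lt_le_trans ltr01 rho_constP. Qed.

Lemma koranyi_similarity_moebius (g g' : heis R k n -> heis R k n) (s : R) :
  0 < s -> cancel g g' -> cancel g' g ->
  (forall p q, D (g p) (g q) = s * D p q) -> moebius D (omap g).
Proof.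
exact: (similarity_moebius rho_const_gt0 koranyi_dist_ge0 koranyi_dist_eq0
  koranyi_quasi_triangle).
Qed.

Lemma heis_mul_moebius a : moebius D (omap (heis_mul a)).
Proof.
apply: (koranyi_similarity_moebius ltr01 (heis_mulK a) (heis_mulKV a)) => p q.
apply: koranyi_dist_eq => //; rewrite expr1n mul1r heis_invM -heis_mulA heis_mulK//.
Qed.

Lemma heis_dil_moebius t : 0 < t -> moebius D (omap (heis_dil t)).
Proof.
move=> t0; have t1 := gt_eqF t0.
apply: (@koranyi_similarity_moebius _ (heis_dil t^-1) t) => // [p|p|p q].
- by rewrite heis_dil_dil mulVf ?t1// heis_dil1.
- by rewrite heis_dil_dil mulfV ?t1// heis_dil1.
- apply: koranyi_dist_eq; first exact: ltW.
  by rewrite -heis_dilV -heis_dilM rho_dil.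
Qed.

Hypothesis kn : (k <= 2)%N || (n.-1 == 1)%N.

Lemma koranyi_dist_inversion p q : p != o -> q != o ->
  D (heis_inversion p) (heis_inversion q) = (D o p)^-1 * (D o q)^-1 * D p q.
Proof.
move=> p0 q0; apply: koranyi_dist_eq.
  by rewrite mulr_ge0 ?invr_ge0 ?koranyi_dist_ge0.
rewrite rho_inversion_dist// !rho_dist_origin mulrC exprMn !exprVn.
by rewrite invfM koranyi_dist4.
Qed.

Lemma koranyi_dist_inversion_origin p : p != o ->
  D o (heis_inversion p) = (D o p)^-1.
Proof.
move=> p0; apply/eqP.
rewrite -(eqrXn2 (n := 4))// ?invr_ge0 ?koranyi_dist_ge0//.
by rewrite exprVn -!rho_dist_origin rho_inversion.
Qed.

Lemma bdry_inversion_moebius : moebius D (bdry_swap (@heis_inversion R k n)).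
Proof.
apply: (bdry_swap_moebius rho_const_gt0 koranyi_dist_ge0 koranyi_dist_eq0
  koranyi_distxx koranyi_distC koranyi_quasi_triangle).
- exact: heis_inversion_neq1.
- exact: heis_inversionK.
- exact: koranyi_dist_inversion.
- exact: koranyi_dist_inversion_origin.
Qed.

End Koranyi.

(** * Metrics with the same Moebius group *)

(** If j is the integer part of m x, then monotonicity places both m h(x) and m x h(1) between j
    h(1) and (j + 1) h(1). Their difference stays below h(1) for every m, which forces h(x) = x
    h(1). *)
Lemma additive_monotone_linear (R : realType) (h : R -> R) :
  {morph h : x y / x + y} -> (forall x, x < 0 -> h x < 0) ->
  forall x, h x = h 1 * x.
Proof.
move=> hD hneg.
have h0 : h 0 = 0 by have := hD 0 0; rewrite addr0; lra.
have hN x : h (- x) = - h x by have := hD x (- x); rewrite subrr h0; lra.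
have hle x y : x <= y -> h x <= h y.
  rewrite le_eqVlt => /predU1P[->//|xy].
  have := hneg (x - y); rewrite subr_lt0 hD hN => /(_ xy); lra.
have hMn m x : h (m%:R * x) = m%:R * h x.
  by elim: m => [|m IHm]; rewrite ?mul0r// -natr1 !mulrDl !mul1r hD IHm.
suff hpos x : 0 <= x -> h x = h 1 * x.
  move=> x; have [/hpos//|x0] := leP 0 x.
  by have := hpos (- x); rewrite oppr_ge0 (ltW x0) hN => /(_ isT); lra.
move=> x0; have h1 : 0 < h 1 by have := hneg (- 1); rewrite hN; lra.
have bound m : `|m%:R * (h x - h 1 * x)| <= h 1.
  have mx0 : 0 <= m%:R * x by rewrite mulr_ge0.
  have /andP[/hle kle /ltW/hle klt] := truncn_itv mx0.
  move: kle klt; rewrite -[X in h X]mulr1 hMn hMn.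
  rewrite -[X in _ <= h X -> _]mulr1 hMn -natr1.
  have /andP[] := truncn_itv mx0; rewrite -natr1.
  move: (Num.trunc _)%:R => j j1 j2; rewrite ler_norml; nra.
apply/eqP; rewrite -subr_eq0; apply/negPn/negP => y0.
have := bound (Num.truncn (h 1 / `|h x - h 1 * x|)).+1.
rewrite normrM normr_nat -ler_pdivlMr ?normr_gt0// leNgt => /negP; apply.
by apply: truncnS_gt.
Qed.

Lemma ln_mul (R : realType) (x y : R) :
  0 < x -> 0 < y -> ln (x * y) = ln x + ln y.
Proof. by move=> x0 y0; rewrite lnM. Qed.

Lemma multiplicative_powR (R : realType) (l : R -> R) :
  (forall t, 0 < t -> 0 < l t) ->
  (forall s t, 0 < s -> 0 < t -> l (s * t) = l s * l t) ->
  (forall t, 0 < t < 1 -> l t < 1) ->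
  exists2 a : R, 0 < a & forall t, 0 < t -> l t = t `^ a.
Proof.
move=> l0 lM l1; pose h x := ln (l (expR x)).
have hD : {morph h : x y / x + y}.
  by move=> x y; rewrite /h expRD lM ?expR_gt0// lnM// posrE l0// expR_gt0.
have hneg x : x < 0 -> h x < 0.
  by move=> x0; rewrite /h ln_lt0// l0 ?expR_gt0//= l1// expR_gt0 expR_lt1.
exists (h 1).
  have := hneg (- 1); have := hD 1 (- 1); have := hD 0 0.
  by rewrite subrr addr0; lra.
move=> t t0; rewrite /powR gt_eqF// -additive_monotone_linear// /h.
by rewrite !lnK ?posrE// l0.
Qed.

(** * Metrics for which translations, dilations and the inversion are Moebius *)

Section MetricGeometry.
Context {R : realType} {k n : nat}.
Implicit Types p q : heis R k n.
Local Notation o := (heis_origin R k n).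
Local Notation D := (@koranyi_dist R k n).
Variable d : heis R k n -> heis R k n -> R.
Hypothesis d_metric : is_metric d.

Lemma is_metric_sym p q : d p q = d q p. Proof. by case: d_metric. Qed.

Lemma is_metric_eq0 p q : d p q = 0 -> p = q.
Proof. by case: d_metric => _ /(_ p q)[]. Qed.

Lemma is_metric_xx p : d p p = 0.
Proof. by case: d_metric => _ /(_ p p)[_ ->]. Qed.

Lemma is_metric_gt0 p q : p != q -> 0 < d p q.
Proof.
case: d_metric => d0 _ _ _ pq; rewrite lt_neqAle d0 andbT eq_sym.
by apply: contra_neq pq; exact: is_metric_eq0.
Qed.

Lemma is_metric_triangle p q r : d p r <= d p q + d q r.
Proof. by case: d_metric. Qed.

(* Cross-ratios with one point at infinity are ratios of distances. *)
Lemma moebius_similarity (f : heis R k n -> heis R k n) (x0 y0 : heis R k n) :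
  x0 != y0 -> moebius d (omap f) ->
  exists2 s : R, 0 < s & forall p q, d (f p) (f q) = s * d p q.
Proof.
move=> xy [[_ [g [fK _ _]]] fcr].
have finj : injective f.
  by move=> p q E; have := can_inj fK (_ : omap f (Some p) = omap f (Some q));
     rewrite /= E => /(_ erefl) [].
have f0 p q : p != q -> f p != f q by apply: contra_neq => /finj.
have ratio p q r : p != q -> p != r -> q != r ->
    d (f q) (f p) / d q p = d (f r) (f p) / d r p.
  move=> pq pr qr.
  have := fcr None (Some p) (Some r) (Some q).
  rewrite /= !inE /= !(inj_eq Some_inj) negb_or pq pr eq_sym qr => /(_ isT).
  rewrite /cross_ratio /= !invr1 !mulr1 !mul1r.
  have a : d q p != 0 by rewrite gt_eqF// is_metric_gt0// eq_sym.
  have b : d r p != 0 by rewrite gt_eqF// is_metric_gt0// eq_sym.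
  have e : d (f r) (f p) != 0 by rewrite gt_eqF// is_metric_gt0// f0// eq_sym.
  move=> /eqP; rewrite eqr_div// => /eqP E.
  by apply/eqP; rewrite eqr_div// E mulrC.
have ratio_sym p q : d (f q) (f p) / d q p = d (f p) (f q) / d p q.
  by rewrite (is_metric_sym q) (is_metric_sym (f q)).
exists (d (f x0) (f y0) / d x0 y0); first by rewrite divr_gt0 ?is_metric_gt0// f0.
have base p : p != x0 -> d (f p) (f x0) / d p x0 = d (f x0) (f y0) / d x0 y0.
  move=> px; rewrite -[RHS]ratio_sym; have [->//|py] := eqVneq p y0.
  by apply: ratio => //; rewrite eq_sym.
move=> p q; have [->|pq] := eqVneq p q; first by rewrite !is_metric_xx mulr0.
rewrite -[LHS](mulfVK (_ : d p q != 0)) ?gt_eqF ?is_metric_gt0//; congr (_ * _).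
have [pE|px] := eqVneq p x0.
  rewrite -[LHS]ratio_sym pE; apply: base.
  by rewrite -pE eq_sym.
rewrite -[LHS]ratio_sym -(base p px) -[RHS]ratio_sym.
have [->|qx] := eqVneq q x0; first by [].
by apply: ratio.
Qed.

Section Invariant.
Hypotheses (k3 : (k <= 3)%N) (kn : (k <= 2)%N || (n.-1 == 1)%N).
Hypothesis d_transl : forall a, moebius d (omap (heis_mul a)).
Hypothesis d_dil : forall t, 0 < t -> moebius d (omap (heis_dil t)).
Hypothesis d_inv : moebius d (bdry_swap (@heis_inversion R k n)).
Variable x0 : heis R k n.
Hypothesis x0_neq : x0 != o.

Lemma metric_translation a p q : d (heis_mul a p) (heis_mul a q) = d p q.
Proof.
have /choice[s sP] : forall b, exists s, 0 < s /\
    forall p q, d (heis_mul b p) (heis_mul b q) = s * d p q.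
  move=> b.
  by have [s s0 sE] := moebius_similarity x0_neq (d_transl b); exists s.
have dx0 : d x0 o != 0 by rewrite gt_eqF// is_metric_gt0.
have sM b b' : s (heis_mul b b') = s b * s b'.
  apply: (mulIf dx0); rewrite -(sP _).2 -!heis_mulA (sP b).2 (sP b').2 mulrA//.
have [l l0 lE] := moebius_similarity x0_neq (d_dil (ltr0Sn R 1)).
have s2 b : s (heis_dil 2 b) = s b.
  apply: (mulIf (mulf_neq0 (lt0r_neq0 l0) dx0)).
  by rewrite -{1}lE -(sP (heis_dil 2 b)).2 -!heis_dilM lE (sP b).2 mulrCA.
(* The dilation of ratio 2 sends a vertical element to its fourth power, so y = s v satisfies y^4 =
   y with y > 0. *)
have s1 v : s (vertical v) = 1.
  have := s2 (vertical v); rewrite heis_dil2_vertical !verticalD !sM.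
  have := (sP (vertical v)).1; move: (s _) => y y0 yE.
  have : (y - 1) * (y * (y * y + y + 1)) = 0.
    by apply: etrans (_ : y * y * (y * y) - y = 0); [ring|rewrite yE subrr].
  move=> /eqP; rewrite mulf_eq0 subr_eq0 => /orP[/eqP //|].
  by rewrite gt_eqF// mulr_gt0// !addr_gt0// mulr_gt0.
(* This element is vertical, so s(a^-1)^2 s(a) = 1; with s(a^-1) s(a) = 1 it follows that s(a) =
   1. *)
have : s (heis_mul (heis_inv a) (heis_mul (heis_inv a) (heis_dil 2 a))) = 1.
  by rewrite heis_dil2.
have : s (heis_mul (heis_inv a) a) = 1.
  by rewrite heis_mulVp -(s1 0).
rewrite !sM s2 => E; rewrite E mulr1 => E1; move: E; rewrite E1 mul1r => sa.
by rewrite (sP a).2 sa mul1r.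
Qed.

Lemma metric_inv p : d o (heis_inv p) = d o p.
Proof. by rewrite -[LHS](metric_translation p) heis_mulpV heis_mulp1 is_metric_sym. Qed.

Lemma metric_left p q : d p q = d o (heis_mul (heis_inv q) p).
Proof. by rewrite -[RHS](metric_translation q) heis_mulp1 heis_mulKV is_metric_sym. Qed.

(** The quadruple (infinity, p, o, q) is mapped to (o, Ip, infinity, Iq); each cross-ratio loses two
    of its factors. *)
Lemma metric_inversion_aux p q : p != o -> q != o -> p != q ->
  d (heis_inversion q) (heis_inversion p) * d o p =
  d o (heis_inversion q) * d q p.
Proof.
move=> p0 q0 pq; have [_ fcr] := d_inv.
have := fcr None (Some p) (Some o) (Some q).
rewrite /= !inE /= !(inj_eq Some_inj) negb_or p0 pq (eq_sym o) q0 => /(_ isT).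
rewrite /cross_ratio /= eqxx (negbTE p0) (negbTE q0) /= !invr1 !mulr1 !mul1r.
have a : d o p != 0 by rewrite gt_eqF// is_metric_gt0// eq_sym.
have b : d (heis_inversion q) o != 0.
  by rewrite gt_eqF// is_metric_gt0// heis_inversion_neq1.
move=> E; rewrite (is_metric_sym o (heis_inversion q)).
by rewrite -[X in X * _](mulfVK b) E; field.
Qed.

(** Exchanging p and x0 in [metric_inversion_aux] gives two relations that share d(Ip, Ix0) and d(p,
    x0); dividing them shows that the product takes the same value at p and at x0. *)
Lemma metric_inversion_prod : exists2 c : R, 0 < c &
  forall p, p != o -> d o (heis_inversion p) * d o p = c.
Proof.
have N p : p != o -> 0 < d o p by move=> p0; rewrite is_metric_gt0// eq_sym.
exists (d o (heis_inversion x0) * d o x0).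
  by rewrite mulr_gt0// N// heis_inversion_neq1.
move=> p p0; have [->//|px] := eqVneq p x0.
have xp : x0 != p by rewrite eq_sym.
have := metric_inversion_aux p0 x0_neq px.
have := metric_inversion_aux x0_neq p0 xp.
rewrite (is_metric_sym (heis_inversion p)) (is_metric_sym p) => E1 E2.
have dd : d (heis_inversion x0) (heis_inversion p) != 0.
  rewrite gt_eqF// is_metric_gt0//; apply: contra_neq px => E.
  by rewrite -(heis_inversionK k3 p0) -E heis_inversionK.
have e : d x0 p != 0 by rewrite gt_eqF// is_metric_gt0.
apply: (mulIf e); rewrite mulrAC -E1 mulrAC [RHS]mulrAC -E2; ring.
Qed.

Variable alpha : R.
Hypothesis alpha_gt0 : 0 < alpha.
Hypothesis d_dilE : forall t p, 0 < t -> d o (heis_dil t p) = t `^ alpha * d o p.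
Hypothesis d_cont0 : exists2 r : R, 0 < r & forall q, D o q < r -> d o q < 1.

(** The function F before normalization; the 4 appears because [rho] is the fourth power of the
    Koranyi distance to o. *)
Let E p : R := ln (d o p) - alpha / 4 * ln (rho p).

Let d_gt0 p : p != o -> 0 < d o p.
Proof. by move=> p0; rewrite is_metric_gt0// eq_sym. Qed.

Let E_dil t p : 0 < t -> p != o -> E (heis_dil t p) = E p.
Proof.
move=> t0 p0; rewrite /E d_dilE// rho_dil.
rewrite (ln_mul (powR_gt0 _ t0) (d_gt0 p0)).
rewrite (ln_mul (exprn_gt0 4 t0) (rho_gt0 p0)) ln_powR lnXn//.
by rewrite -mulr_natl; field.
Qed.

Let E_inv p : E (heis_inv p) = E p.
Proof. by rewrite /E metric_inv rhoV. Qed.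

(** A dilation brings p to Koranyi distance r/2 from o, where d(o,.) < 1 and the first term of E is
    negative. *)
Let E_bounded : exists M, forall p, p != o -> E p <= M.
Proof.
have [r r0 rP] := d_cont0; exists (- alpha * ln (r / 2)) => p p0.
have Dp : 0 < D o p by rewrite koranyi_dist_gt0// eq_sym.
pose t := r / 2 / D o p; have t0 : 0 < t by rewrite !divr_gt0.
have : d o (heis_dil t p) < 1.
  apply: rP; rewrite (@koranyi_dist_eq _ _ _ _ _ o p t) ?(ltW t0)//.
    by rewrite /t mulfVK ?gt_eqF//; lra.
  by rewrite !heis_mulp1 !rhoV rho_dil.
rewrite d_dilE// => H.
have : ln (t `^ alpha * d o p) < 0.
  by rewrite ln_lt0// H mulr_gt0 ?powR_gt0 ?d_gt0.
rewrite lnM ?posrE ?powR_gt0 ?d_gt0// ln_powR /t ln_div ?posrE ?divr_gt0//.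
rewrite /E rho_dist_origin lnXn// -mulr_natl; lra.
Qed.

Lemma metric_eq_koranyi : exists2 b : R, 0 < b &
  forall p q, d p q = b * D p q `^ alpha.
Proof.
have [c c0 cP] := metric_inversion_prod.
(* Since E(p) + E(Ip) = ln c, subtracting half of it makes F odd under I. *)
pose F p := E p - ln c / 2.
have Fi p : p != o -> F (heis_inversion p) = - F p.
  move=> p0; rewrite /F /E rho_inversion// lnV ?posrE ?rho_gt0// -(cP p p0).
  rewrite (ln_mul (d_gt0 (heis_inversion_neq1 k3 p0)) (d_gt0 p0)); lra.
have Fd t p : 0 < t -> p != o -> F (heis_dil t p) = F p.
  by move=> t0 p0; rewrite /F E_dil.
have neqV p q : p != q -> heis_mul (heis_inv q) p != o.
  apply: contra_neq => H.
  by rewrite -(heis_mulKV q p) H heis_mulp1.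
have Fii p q : p != o -> q != o -> p != q ->
    F (heis_mul (heis_inv (heis_inversion q)) (heis_inversion p)) =
    F (heis_mul (heis_inv q) p) - F p - F q.
  move=> p0 q0 pq; rewrite /F /E -!metric_left rho_inversion_dist//.
  have ipq : heis_inversion p != heis_inversion q.
    apply: contra_neq pq => H.
    by rewrite -(heis_inversionK k3 p0) H heis_inversionK.
  have Ip0 := heis_inversion_neq1 k3 p0; have qp : q != p by rewrite eq_sym.
  have := metric_inversion_aux q0 p0 qp => /(congr1 (@ln R)).
  rewrite (ln_mul (is_metric_gt0 ipq) (d_gt0 q0)).
  rewrite (ln_mul (d_gt0 Ip0) (is_metric_gt0 pq)).
  rewrite ln_div ?posrE ?mulr_gt0 ?rho_gt0 ?neqV//.
  rewrite (ln_mul (rho_gt0 p0) (rho_gt0 q0)).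
  rewrite -(cP p p0) (ln_mul (d_gt0 Ip0) (d_gt0 p0)); lra.
have Fh p : p != o -> p.1 = 0 \/ p.2 = 0 -> F p = 0.
  move=> p0 H; suff : F (heis_inversion p) = F p by rewrite Fi//; lra.
  case: H => H; last first.
    rewrite heis_inversion_horizontal// Fd// invr_gt0 lt_neqAle vec_sqnorm_ge0.
    rewrite andbT eq_sym vec_sqnorm_eq0; apply: contra_neq p0 => H1.
    by apply: heis_eq; rewrite ?H1 ?H.
  have t0 : 0 < (Num.sqrt (rho p))^-1 by rewrite invr_gt0 sqrtr_gt0 rho_gt0.
  by rewrite heis_inversion_vertical// /F E_inv -/(F _) Fd.
have step M : (forall p, p != o -> F p <= M) ->
    forall p, p != o -> 3 * F p <= 2 * M.
  move=> FM p p0.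
  have FMn q : q != o -> - M <= F q.
    by move=> q0; have := FM _ (heis_inversion_neq1 k3 q0); rewrite Fi//; lra.
  have sub q q' : q != o -> q' != o -> q != q' ->
      F q + F q' - M <= F (heis_mul (heis_inv q') q).
    move=> q0 q'0 qq'; have := Fii q q' q0 q'0 qq'.
    have := FMn (heis_mul (heis_inv (heis_inversion q')) (heis_inversion q)).
    have -> : heis_mul (heis_inv (heis_inversion q')) (heis_inversion q) != o.
      apply: neqV; apply: contra_neq qq' => H.
      by rewrite -(heis_inversionK k3 q0) H heis_inversionK.
    move=> /(_ isT); lra.
  (* For horizontal p the relation would end at o, where F has no meaning; there F p = 0, and the
     bound at p itself says that M is nonnegative. *)
  have [v0|v0] := eqVneq p.2 0.
    by have := FM p p0; rewrite Fh//; [lra|right].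
  have vv : vertical (p.2 + p.2) != o.
    apply: contra_neq v0 => /(congr1 (fun x : heis R k n => x.2)) /= vv.
    apply/val_inj; rewrite -[LHS]scale1r (_ : 1 = 2^-1 + 2^-1 :> R); last by lra.
    rewrite scalerDl -scalerDr; have /= -> := congr1 (@imag_val R k) vv.
    exact: scaler0.
  have d20 : heis_dil 2 p != o by rewrite heis_dil_eq1.
  have d2p : heis_dil 2 p != p.
    apply/eqP => /(congr1 rho); rewrite rho_dil; have := rho_gt0 p0; lra.
  have up : heis_mul (heis_inv p) (heis_dil 2 p) != p.
    by apply: contra_neq vv => H; rewrite -heis_dil2 H heis_mulVp.
  (* With u = p^-1 (2.p), these give 2 F(p) - M <= F(u) and F(u) + F(p) - M <= 0, the last value
     being F at the vertical point p^-1 u. *)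
  have := sub _ _ (neqV _ _ d2p) p0 up; have := sub _ _ d20 p0 d2p.
  by rewrite heis_dil2 Fd// (Fh _ vv); [lra|left].
have [M0 M0P] := E_bounded.
pose S := [set F p | p in [set p | p != o]].
have S_sup : has_sup S.
  split; first by exists (F x0), x0.
  by exists (M0 - ln c / 2) => _ [p p0 <-]; rewrite lerB// M0P.
have FS p : p != o -> F p <= sup S.
  by move=> p0; apply: sup_upper_bound => //; exists p.
have F0 p : p != o -> F p <= 0.
  move=> p0; apply: le_trans (FS p p0) _.
  (* [step] is applied with M equal to the supremum itself. *)
  have : sup S <= 2 / 3 * sup S.
    apply: ge_sup; first by exists (F x0), x0.
    by move=> _ [q q0 <-]; have := step _ FS q q0; lra.
  lra.
have FE p : p != o -> F p = 0.
  move=> p0; apply/eqP; rewrite eq_le F0//=.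
  by have := F0 _ (heis_inversion_neq1 k3 p0); rewrite Fi//; lra.
(* F = 0 reads d(o,p) = sqrt(c) D(o,p)^alpha, so beta is sqrt(c). *)
exists (expR (ln c / 2)); first exact: expR_gt0.
move=> p q; have [->|pq] := eqVneq p q.
  by rewrite is_metric_xx koranyi_distxx powR0 ?mulr0 ?gt_eqF.
have w0 := neqV _ _ pq.
have := FE _ w0; rewrite /F /E -metric_left -koranyi_dist4 lnXn ?koranyi_dist_gt0//.
move=> H; rewrite -[LHS]lnK ?posrE ?is_metric_gt0// /powR gt_eqF ?koranyi_dist_gt0//.
rewrite -expRD; congr expR; move: H; rewrite -mulr_natl; lra.
Qed.

End Invariant.
End MetricGeometry.

Lemma expr_small (R : realType) (t e : R) : 0 < t < 1 -> 0 < e ->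
  exists m, t ^+ m < e.
Proof.
move=> /andP[t0 t1] e0.
have t1' : `|t| < 1 by rewrite gtr0_norm.
have /cvgrPdist_lt/(_ e e0) [m _ mP] := cvg_expr t1'.
by exists m; have := mP m (leqnn m); rewrite /= sub0r normrN gtr0_norm ?exprn_gt0.
Qed.

(** * The exponent by which dilations scale the metric *)

Section DilationExponent.
Context {R : realType} {k n : nat}.
Implicit Types p q : heis R k n.
Local Notation o := (heis_origin R k n).
Local Notation D := (@koranyi_dist R k n).
Variable d : heis R k n -> heis R k n -> R.
Hypothesis d_metric : is_metric d.

(** The open d-ball about o, without infinity, is open for d and hence for the Koranyi distance;
    openness at o provides r. *)
Lemma same_topology_small (same_topology : forall U : set (option (heis R k n)),
     @open (bdry d) U <-> @open (bdry D) U) (s : R) : 0 < s ->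
  exists2 r : R, 0 < r & forall q, D o q < r -> d o q < s.
Proof.
move=> s0; pose U : set (option (heis R k n)) :=
  [set x | if x is Some q then d o q < s else False].
have /same_topology [+ _] : @open (bdry d) U.
  split=> // p /= ps; exists (s - d o p); first by rewrite subr_gt0.
  move=> q pq; have := is_metric_triangle d_metric o p q; rewrite /U /=; lra.
by move=> /(_ o); apply; rewrite /= is_metric_xx.
Qed.

Hypothesis d_dil : forall t, 0 < t -> moebius d (omap (heis_dil t)).
Hypothesis d_small : forall s : R, 0 < s ->
  exists2 r : R, 0 < r & forall q, D o q < r -> d o q < s.
Variable x0 : heis R k n.
Hypothesis x0_neq : x0 != o.

Lemma metric_dilation : exists2 alpha, 0 < alpha &
  forall t p q, 0 < t -> d (heis_dil t p) (heis_dil t q) = t `^ alpha * d p q.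
Proof.
have /choice[l lP] : forall t, exists s, 0 < t -> 0 < s /\
    forall p q, d (heis_dil t p) (heis_dil t q) = s * d p q.
  move=> t; have [t0|_] := ltP 0 t; last by exists 0.
  by have [s s0 sE] := moebius_similarity d_metric x0_neq (d_dil t0); exists s.
have dx0 : d o x0 != 0 by rewrite gt_eqF// is_metric_gt0// eq_sym.
have lM s t : 0 < s -> 0 < t -> l (s * t) = l s * l t.
  move=> s0 t0; apply: (mulIf dx0).
  rewrite -(lP _ (mulr_gt0 s0 t0)).2 -!heis_dil_dil (lP _ s0).2 (lP _ t0).2.
  by rewrite mulrA.
have lX t m : 0 < t -> l (t ^+ m.+1) = l t ^+ m.+1.
  move=> t0; elim: m => [//|m IHm].
  by rewrite exprS lM ?exprn_gt0// IHm -exprS.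
(* A power of t moves x0 into a Koranyi ball on which d(o,.) < d(o,x0), so a positive power of l t
   is below 1. *)
have l1 t : 0 < t < 1 -> l t < 1.
  move=> t01; have /andP[t0 t1] := t01.
  have d0 : 0 < d o x0 by rewrite is_metric_gt0// eq_sym.
  have D0 : 0 < D o x0 by rewrite koranyi_dist_gt0// eq_sym.
  have [r r0 rP] := d_small d0.
  have [m mP] := expr_small t01 (divr_gt0 r0 D0).
  have tm0 : 0 < t ^+ m.+1 by rewrite exprn_gt0.
  have : d o (heis_dil (t ^+ m.+1) x0) < d o x0.
    apply: rP; rewrite (@koranyi_dist_eq _ _ _ _ _ o x0 (t ^+ m.+1)) ?(ltW tm0)//.
      rewrite -ltr_pdivlMr// (le_lt_trans _ mP)// exprS ler_piMl ?exprn_ge0 ?ltW//.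
    by rewrite !heis_mulp1 !rhoV rho_dil.
  rewrite -{1}(heis_dil_origin (t ^+ m.+1)) (lP _ tm0).2 lX//.
  rewrite gtr_pMl// => lt1; rewrite ltNge; apply/negP => le1.
  by move: lt1; rewrite ltNge exprn_ege1.
have [a a0 aE] := multiplicative_powR (fun t t0 => (lP t t0).1) lM l1.
by exists a => // t p q t0; rewrite (lP _ t0).2 aE.
Qed.

End DilationExponent.

(** * The theorem, with the bound on alpha and the values at infinity *)

Unset Implicit Arguments.

Theorem mainTheorem1 (R : realType) (K : scalars) (n : nat)
  (n_ge2 : (2 <= n)%N) (octonions_n : K = Octonions -> n = 2%N)
  (d : heis R K n -> heis R K n -> R)
  (d_metric : is_metric d)
  (same_topology : forall U : set (option (heis R K n)),
     @open (bdry d) U <-> @open (bdry (@koranyi_dist R K n)) U)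
  (same_moebius : moebius d = moebius (@koranyi_dist R K n)) :
  exists alpha beta : R,
    [/\ 0 < alpha <= 1, 0 < beta &
      forall x y : option (heis R K n),
        ext_dist d x y =
        (beta%:E * ext_dist (@koranyi_dist R K n) x y `^ alpha)%E].
Proof.
have k3 : (K <= 3)%N by case: (K).
have kn : (K <= 2)%N || (n.-1 == 1)%N.
  by case: (K) octonions_n => //= ->.
pose o := heis_origin R K n.
(* A point other than o, available since n >= 2. Being horizontal, it also satisfies x0 x0 = 2.x0,
   which bounds alpha. *)
pose x0 : heis R K n := (const_mx (cd_one K), 0).
have x0_neq : x0 != o.
  have n1 : (0 < n.-1)%N by case: (n) n_ge2 => [|[]].
  apply/eqP => /(congr1 fst)/rowP/(_ (Ordinal n1)); rewrite !mxE.
  by move=> /eqP; rewrite -cd_sqnorm_eq0 cd_sqnorm1 oner_eq0.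
have d_transl a : moebius d (omap (heis_mul a)).
  by rewrite same_moebius; exact: heis_mul_moebius.
have d_dil t : 0 < t -> moebius d (omap (heis_dil t)).
  by rewrite same_moebius; exact: heis_dil_moebius.
have d_inv : moebius d (bdry_swap (@heis_inversion R K n)).
  by rewrite same_moebius; exact: bdry_inversion_moebius.
have small := same_topology_small d_metric same_topology.
have [alpha alpha0 dilE] := metric_dilation d_metric d_dil small x0_neq.
have dilo t p : 0 < t -> d o (heis_dil t p) = t `^ alpha * d o p.
  by move=> t0; rewrite -dilE// heis_dil_origin.
have [beta beta0 dE] := metric_eq_koranyi d_metric k3 kn d_transl d_dil d_inv
  x0_neq alpha0 dilo (small _ ltr01).
exists alpha, beta; split=> //.
  rewrite alpha0 /=.
  have x00 : heis_mul x0 x0 = heis_dil 2 x0.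
    apply: heis_eq; first by apply/rowP => i; rewrite !mxE scaler_nat mulr2n.
    rewrite heis_dil_snd scaler0 -[(heis_mul x0 x0).2]/(0 + 0 + omega x0.1 x0.1 *+ 2).
    by rewrite omegazz mul0rn !addr0.
  (* By left invariance this becomes 2^alpha d(o,x0) <= 2 d(o,x0), hence alpha <= 1. *)
  have := is_metric_triangle d_metric o x0 (heis_mul x0 x0).
  have -> : d x0 (heis_mul x0 x0) = d o x0.
    rewrite -(metric_translation d_metric d_transl d_dil x0_neq x0 o x0).
    by rewrite heis_mulp1.
  rewrite x00 dilo//; have -> : d o x0 + d o x0 = 2 * d o x0 by ring.
  rewrite ler_pM2r; last first.
    by apply: is_metric_gt0 => //; rewrite eq_sym.
  move=> H; have : ln (2 `^ alpha) <= ln 2 by rewrite ler_ln ?posrE ?powR_gt0.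
  by rewrite ln_powR ger_pMl// ln_gt0// ltr1n.
(* Because alpha is nonzero, the power sends +oo to +oo and 0 to 0; beta > 0 then keeps +oo
   infinite. *)
case=> [p|] [q|] /=.
- by rewrite dE EFinM.
- by rewrite gt_eqF// gt0_muley ?lte_fin.
- by rewrite gt_eqF// gt0_muley ?lte_fin.
- by rewrite powR0 ?gt_eqF// mule0.
Qed.
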